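(* Let $(X_1,Y_1),(X_2,Y_2),\dots$ be a random sample (i.i.d. copies) of a random vector $(X,Y)$ with continuous joint distribution function $H$, marginal distribution functions $F$ and $G$, and (unique) copula $A$. Assume that $A$ allows a continuous Markov kernel $K_A$, define $K_H(x,(-\infty,y]):=K_A(F(x),[0,G(y)])$, and set $N(n):=\lfloor n^s\rfloor$ for some $s\in(0,\tfrac12)$. Let $x\in\mathbb{R}$ be a point in which the regularity assumption holds, i.e. the sequence $(Z_n^{(x)})_{n\in\mathbb{N}}$ is uniformly integrable, where $Z_n^{(x)}$ has distribution function $y\mapsto K_{\mathcal{CB}_{N(n)}(E_n)}(F_n(x),[0,G_n(y)])$. Define $$r_n^+(x):=\int_{(0,\infty)}1-K_{\mathcal{CB}_{N(n)}(E_n)}(F_n(x),[0,G_n(y)])\,d\lambda(y),\qquad r_n^-(x):=\int_{(-\infty,0)}K_{\mathcal{CB}_{N(n)}(E_n)}(F_n(x),[0,G_n(y)])\,d\lambda(y),$$ and $r_n(x):=r_n^+(x)-r_n^-(x)$. Then $r_n(x)\to\mathbb{E}[Y\mid X=x]$ almost surely as $n\to\infty$, where $\mathbb{E}[Y\mid X=x]:=\int_{\mathbb{R}}y\,K_H(x,dy)$.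
   Context: A (bivariate) copula is a distribution function on $[0,1]^2$ with uniform marginals; each copula $B$ corresponds to a doubly stochastic measure $\mu_B$ with $B(x,y)=\mu_B([0,x]\times[0,y])$. A Markov kernel of a copula $B$ is a map $K_B:[0,1]\times\mathcal{B}([0,1])\to[0,1]$, measurable in the first argument, a probability measure in the second, with $\int_{E_1}K_B(x,E_2)\,d\lambda(x)=\mu_B(E_1\times E_2)$ for all Borel $E_1,E_2\subseteq[0,1]$ ($\lambda$ = Lebesgue measure). $A$ allows a continuous Markov kernel if it has a version $K_A$ with $(x,y)\mapsto K_A(x,[0,y])$ continuous on $[0,1]^2$; $K_A$ denotes this version, and $K_H(x,\cdot)$ is the probability measure on $\mathbb{R}$ with the stated distribution function. Checkerboard approximation: $I_1^N=[0,\tfrac1N]$, $I_i^N=(\tfrac{i-1}N,\tfrac iN]$ ($i=2,\dots,N$), $Q_{i,j}^N=I_i^N\times I_j^N$; for a copula $B$, $K_{\mathcal{CB}_N(B)}(u,[0,v])=N^2\sum_{i,j=1}^N\mu_B(Q^N_{i,j})\mathbf 1_{I^N_i}(u)\,\lambda([0,v]\cap I^N_j)$ is the Markov kernel of the absolutely continuous copula $\mathcal{CB}_N(B)$ with density $N^2\sum_{i,j}\mu_B(Q^N_{i,j})\mathbf 1_{Q^N_{i,j}}$. $F_n,G_n$ are the univariate empirical distribution functions of the first $n$ observations; $E_n$ is the empirical copula: with $H_n$ the bivariate empirical distribution function, almost surely there is a unique subcopula $E_n'$ on $\{0,\tfrac1n,\dots,1\}^2$ with $H_n(x,y)=E_n'(F_n(x),G_n(y))$,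 and $E_n$ is its extension to a copula by bilinear interpolation on each square $[\tfrac{i-1}n,\tfrac in]\times[\tfrac{j-1}n,\tfrac jn]$. *)

(* Defs.v *)
From HB Require Import structures.
From mathcomp Require Import all_boot all_order all_algebra.
From mathcomp Require Import all_classical all_reals all_analysis.
Set Implicit Arguments. Unset Strict Implicit. Unset Printing Implicit Defensive.
Import Order.TTheory GRing.Theory Num.Theory.
Import numFieldNormedType.Exports.
Local Open Scope classical_set_scope.
Local Open Scope ring_scope.

Section defs.
Context {R : realType} {d : measure_display} {Omega : measurableType d}.
Variable P : probability Omega R.

Definition iid_pairs (X Y : nat -> Omega -> R) : Prop :=
  (forall (I : seq nat) (B : nat -> set (R * R)%type), uniq I ->
     (forall k, measurable (B k)) ->
     P [set w | forall k, k \in I -> B k (X k w, Y k w)] =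
     (\big[*%E/1%E]_(k <- I) P [set w | B k (X k w, Y k w)])%E) /\
  (forall k (B : set (R * R)%type), measurable B ->
     P [set w | B (X k w, Y k w)] = P [set w | B (X 0%N w, Y 0%N w)]).

Definition joint_df (X Y : nat -> Omega -> R) (x y : R) : R :=
  fine (P [set w | X 0%N w <= x /\ Y 0%N w <= y]).
Definition marg_df (X : nat -> Omega -> R) (x : R) : R :=
  fine (P [set w | X 0%N w <= x]).

Definition emp_df (X : nat -> Omega -> R) (n : nat) (w : Omega) (x : R) : R :=
  (\sum_(k < n) ((X k w <= x)%R)%:R) / n%:R.

(* the subcopula E_n' (defined on all of R^2); H_n(x,y) = E_n'(F_n x, G_n y) *)
Definition emp_subcop (X Y : nat -> Omega -> R) (n : nat) (w : Omega)
    (u v : R) : R :=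
  (\sum_(k < n) ((emp_df X n w (X k w) <= u) &&
                  (emp_df Y n w (Y k w) <= v))%R%:R) / n%:R.

End defs.

Section copdefs.
Context {R : realType}.

Definition bilin_interp (E' : R -> R -> R) (n : nat) (u v : R) : R :=
  let p := Order.min (Num.floor (n%:R * u))%:~R (n%:R - 1) in
  let q := Order.min (Num.floor (n%:R * v))%:~R (n%:R - 1) in
  let a := n%:R * u - p in
  let b := n%:R * v - q in
  (1 - a) * (1 - b) * E' (p / n%:R) (q / n%:R)
  + a * (1 - b) * E' ((p + 1) / n%:R) (q / n%:R)
  + (1 - a) * b * E' (p / n%:R) ((q + 1) / n%:R)
  + a * b * E' ((p + 1) / n%:R) ((q + 1) / n%:R).

Definition cb_int (N i : nat) : set R :=
  if i == 1%N then `[0, 1 / N%:R]%classic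
  else `]((i%:R - 1) / N%:R), (i%:R / N%:R)]%classic.

Definition cb_mass (B : R -> R -> R) (N i j : nat) : R :=
  B (i%:R / N%:R) (j%:R / N%:R) - B ((i%:R - 1) / N%:R) (j%:R / N%:R)
  - B (i%:R / N%:R) ((j%:R - 1) / N%:R)
  + B ((i%:R - 1) / N%:R) ((j%:R - 1) / N%:R).

Definition cb_kernel (B : R -> R -> R) (N : nat) (u v : R) : R :=
  N%:R ^+ 2 * \sum_(1 <= i < N.+1) \sum_(1 <= j < N.+1)
    cb_mass B N i j * \1_(cb_int N i) u *
    fine (lebesgue_measure (`[0, v]%classic `&` cb_int N j)).

(* copula given through its doubly stochastic measure *)
Definition unit_sq : set (R * R)%type := `[0, 1]%classic `*` `[0, 1]%classic.

Definition doubly_stochastic (mu : probability (R * R)%type R) : Prop :=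
  mu (~` unit_sq) = 0%E /\
  forall E : set R, measurable E -> E `<=` `[0, 1]%classic ->
    mu (E `*` `[0, 1]%classic) = lebesgue_measure E /\
    mu (`[0, 1]%classic `*` E) = lebesgue_measure E.

Definition copula_of (mu : probability (R * R)%type R) (u v : R) : R :=
  fine (mu (`[0, u]%classic `*` `[0, v]%classic)).

Definition markov_kernel_of (mu : probability (R * R)%type R)
    (K : R.-pker R ~> R) : Prop :=
  (forall u, 0 <= u <= 1 -> K u `[0, 1]%classic = 1%E) /\
  forall E1 E2 : set R, measurable E1 -> measurable E2 ->
    E1 `<=` `[0, 1]%classic -> E2 `<=` `[0, 1]%classic ->
    (\int[lebesgue_measure]_(u in E1) K u E2)%E = mu (E1 `*` E2).

Definition continuous_kernel (K : R.-pker R ~> R) : Prop :=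
  {within unit_sq, continuous (fun p : R * R => fine (K p.1 `[0, p.2]%classic))}.

Definition unif_integrable (nu : nat -> probability R R) : Prop :=
  forall e : R, 0 < e -> exists c : R, forall n, (0 < n)%N ->
    (\int[nu n]_(y in [set y : R | (c < `|y|)%R]) (`|y|)%:E <= e%:E)%E.

End copdefs.

Section estimator.
Context {R : realType} {d : measure_display} {Omega : measurableType d}.

Definition Nn (s : R) (n : nat) : nat := `|Num.floor (n%:R `^ s)|%N.

Definition est_df (X Y : nat -> Omega -> R) (s : R) (n : nat) (w : Omega)
    (x y : R) : R :=
  cb_kernel (bilin_interp (emp_subcop X Y n w) n) (Nn s n)
    (emp_df X n w x) (emp_df Y n w y).

Definition r_plus (X Y : nat -> Omega -> R) (s : R) (n : nat) (w : Omega) (x : R) : \bar R :=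
  (\int[@lebesgue_measure R]_(y in `]0%R, +oo[%classic) (1 - est_df X Y s n w x y)%:E)%E.
Definition r_minus (X Y : nat -> Omega -> R) (s : R) (n : nat) (w : Omega) (x : R) : \bar R :=
  (\int[@lebesgue_measure R]_(y in `]-oo, 0%R[%classic) (est_df X Y s n w x y)%:E)%E.
Definition r_est (X Y : nat -> Omega -> R) (s : R) (n : nat) (w : Omega) (x : R) : \bar R := (r_plus X Y s n w x - r_minus X Y s n w x)%E.

Definition regular_at (X Y : nat -> Omega -> R) (s x : R) (w : Omega) : Prop :=
  exists nu : nat -> probability R R,
    (forall n, (0 < n)%N -> forall y,
       nu n `]-oo, y]%classic = (est_df X Y s n w x y)%:E) /\
    unif_integrable nu.

End estimator.

(* Main.v *)
Require Import Defs.
From HB Require Import structures.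
From mathcomp Require Import all_boot all_order all_algebra.
From mathcomp Require Import all_classical all_reals all_analysis.
From mathcomp Require Import measurable_realfun ring lra.
Import Order.TTheory GRing.Theory Num.Theory.
Import numFieldNormedType.Exports.
Local Open Scope classical_set_scope.
Local Open Scope ring_scope.

(** Put [U_k = F(X_k)], [V_k = G(Y_k)]; their joint distribution function is
    the copula [A] on the unit square.  A Chernoff bound, a union bound over a
    grid of [O(n^2)] points and Borel-Cantelli show that almost surely the
    empirical distribution function of the [(U_k, V_k)] is eventually within
    [D_n = n^-b + 2/n] of [A], uniformly, for any [b < 1/2]; choose [s < b].
    Sandwiching then gives [|E_n - A| <= 3 D_n + 2/n].  On a column [I_i] of
    the grid of mesh [1/N] the checkerboard kernel of a copula [B] interpolates
    the slopes [N (B(i/N, v) - B((i-1)/N, v))], so replacing [E_n] by [A] costs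
    at most [4 N (3 D_n + 2/n)], which tends to [0] because [N <= n^s], whereas
    for [B = A] the slopes are averages over [I_i] of the continuous kernel and
    converge to it.  Hence the conditional distribution functions converge
    pointwise, and uniform integrability upgrades this to convergence of the
    means through the layer-cake formula. *)

(** The rate results from two competing requirements. At deviation [n^-b] the Chernoff exponent has
    order [n^(1 - 2 b)], which beats the number of grid points only if [b < 1/2]. Passing to
    conditional distribution functions divides by the mesh [1/N], which amplifies the error to order
    [n^(s - b)] and demands [b > s]. This is where [s < 1/2] enters. The marginals may be flat and
    may fail to attain 0 or 1, so [F (X k) <= F x] does not give back [X k <= x], and Sklar's
    identity is silent on parts of the boundary of the square. Events are therefore compared after a
    small shift of the level, and the Lipschitz continuity of the joint distribution function of the
    transformed sample absorbs the shift. That function is used on the whole plane, because shifted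
    arguments leave the square. The uniform bound holds on one event for all arguments at once, so
    convergence at every [y] holds off a single null set, and the passage to means is a
    deterministic statement about each path. *)

(** * Chernoff bound for independent events of equal probability *)

Section hoeffding.
Context {R : realType} {d : measure_display} {Omega : measurableType d}.
Variable P : probability Omega R.

Lemma measurable_set_forall_in (A : nat -> set Omega) (I : seq nat) :
  (forall k, measurable (A k)) ->
  measurable [set w | forall k, k \in I -> A k w].
Proof.
move=> mA; rewrite (_ : [set w | _] = \bigcap_(k in [set` I]) A k).
  exact: bigcap_measurableType.
by apply/seteqP; split => w /= h k; exact: h.
Qed.

(** Generalized over [I] so that induction on [n] works: the factor
    [\1_(A n)] moves the index [n] into [I]. *)
Lemma integral_prod_indep (A : nat -> set Omega) (p c : R) (n : nat)
    (I : seq nat) :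
  (forall k, measurable (A k)) ->
  (forall J : seq nat, uniq J ->
    P [set w | forall k, k \in J -> A k w] = (p ^+ size J)%:E) ->
  0 <= c -> uniq I -> {in I, forall k, (n <= k)%N} ->
  (\int[P]_(w in [set w | forall k, k \in I -> A k w])
     (\prod_(k < n) (1 + c * \1_(A k) w))%:E
   = ((1 + c * p) ^+ n * p ^+ size I)%:E)%E.
Proof.
move=> mA indA c0; elim: n I => [|n IH] I uI nI.
  under eq_integral do rewrite big_ord0.
  rewrite integral_cst ?mul1e; last exact: measurable_set_forall_in.
  by rewrite expr0 mul1r; exact: indA.
set D := [set w | _]; have mD : measurable D by exact: measurable_set_forall_in.
pose f (w : Omega) : R := \prod_(k < n) (1 + c * \1_(A k) w).
have f0 w : 0 <= f w.
  by apply: prodr_ge0 => k _; rewrite addr_ge0// mulr_ge0.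
have mf : measurable_fun setT f.
  apply: measurable_prod => k _.
  by apply: measurable_funD => //; apply: measurable_funM => //; exact: measurable_indic.
have nI' : n \notin I by apply/negP => /nI; rewrite ltnn.
transitivity (\int[P]_(w in D) ((f w)%:E + (c * f w * \1_(A n) w)%:E))%E.
  apply: eq_integral => w _; rewrite big_ord_recr/= -/(f w) -EFinD.
  by congr EFin; ring.
rewrite ge0_integralD//; last 4 first.
- by move=> w _; rewrite lee_fin.
- by apply/measurable_EFinP; exact: measurable_funTS.
- by move=> w _; rewrite lee_fin mulr_ge0// mulr_ge0.
- apply/measurable_EFinP; apply: measurable_funTS.
  apply: measurable_funM; last exact: measurable_indic.
  exact: measurable_funM.
rewrite IH//; last by move=> k /nI /ltnW.
have -> : (\int[P]_(w in D) (c * f w * \1_(A n) w)%:E =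
   c%:E * \int[P]_(w in [set w | forall k, k \in n :: I -> A k w]) (f w)%:E)%E.
  under eq_integral do rewrite -mulrA EFinM.
  rewrite ge0_integralZl//; last 2 first.
  - apply/measurable_EFinP; apply: measurable_funTS.
    by apply: measurable_funM => //; exact: measurable_indic.
  - by move=> w _; rewrite lee_fin mulr_ge0.
  rewrite [X in (\int[P]_(_ in X) (f _)%:E)%E](_ : _ = D `&` A n); last first.
    apply/seteqP; split => [w /= h|w [/= h1 h2] k].
      by split=> [k kI|]; apply: h; rewrite inE ?kI ?orbT ?eqxx.
    by rewrite inE => /predU1P[->//|/h1].
  rewrite integral_mkcondr; congr (_ * _)%E; apply: eq_integral => w _.
  by rewrite patchE indicE; case: ifP => _; rewrite ?mulr1 ?mulr0.
rewrite IH/=; last 2 first.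
- by rewrite nI'.
- by move=> k; rewrite inE => /predU1P[->//|/nI /ltnW].
by rewrite -EFinM -EFinD; congr EFin; rewrite !exprS; ring.
Qed.

(** From [1 - l <= exp (- l)] one gets [(1 - l) * exp l <= 1], while [(1 - l) * (1 + l + 2 l^2) = 1
    + l^2 * (1 - 2 l)] is at least 1 as long as [l <= 1/2]. *)
Lemma expR_le_quadratic (l : R) : 0 <= l <= 1 / 2 -> expR l <= 1 + l + 2 * l ^+ 2.
Proof.
move=> /andP[l0 l1]; have := expR_ge1Dx (- l); rewrite expRN => h.
have e0 := expR_gt0 l.
have {}h : (1 - l) * expR l <= 1 by rewrite -ler_pdivlMr// div1r.
have h2 : (1 - l) * expR l <= (1 - l) * (1 + l + 2 * l ^+ 2) by nra.
by rewrite -(ler_pM2l (_ : 0 < 1 - l))//; lra.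
Qed.

Lemma prob_sum_indic_ge (A : nat -> set Omega) (p t : R) (n : nat) :
  (forall k, measurable (A k)) ->
  (forall J : seq nat, uniq J ->
    P [set w | forall k, k \in J -> A k w] = (p ^+ size J)%:E) ->
  0 <= p <= 1 -> 0 <= t <= 2 ->
  (P [set w | (n%:R * (p + t) <= \sum_(k < n) \1_(A k) w :> R)%R]
   <= (expR (- (n%:R * t ^+ 2 / 8)))%:E)%E.
Proof.
move=> mA indA /andP[p0 p1] /andP[t0 t2].
(* Chernoff bound: [l = t / 4] minimizes the exponent [n (2 l^2 - l t)]. *)
pose l := t / 4; have l0 : 0 <= l by rewrite /l; lra.
have l1 : l <= 1 / 2 by rewrite /l; lra.
pose c := expR l - 1; have c0 : 0 <= c by rewrite subr_ge0 -expR0 ler_expR.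
pose S w : R := \sum_(k < n) \1_(A k) w.
(* An indicator takes the values 0 and 1 only, so [exp (l * \1_A) = 1 + c * \1_A]. Thus
   [exp (l * S)], to which Markov's inequality is applied, is a product of the form handled by
   [integral_prod_indep]. *)
pose f (w : Omega) : R := \prod_(k < n) (1 + c * \1_(A k) w).
have fE w : f w = expR (l * S w).
  rewrite /f /S mulr_sumr expR_sum; apply: eq_bigr => k _.
  rewrite /c indicE; case: (_ \in _); rewrite ?mulr1 ?mulr0 ?expR0 ?addr0//.
  by rewrite addrCA subrr addr0.
have mS : measurable_fun setT S.
  by apply: measurable_sum => k; exact: measurable_indic.
have mf : measurable_fun setT f.
  by apply: measurable_prod => k _; apply: measurable_funD => //;
    apply: measurable_funM => //; exact: measurable_indic.
have f0 w : 0 <= f w by rewrite fE expR_ge0.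
set E := [set w | _]; have mE : measurable E.
  rewrite -[E]setTI; apply: (measurable_fun_le (f := cst (n%:R * (p + t)))) => //.
pose a := expR (l * (n%:R * (p + t))).
have a0 : 0 < a by exact: expR_gt0.
have h1 : (a%:E * P E <= \int[P]_w (f w)%:E)%E.
  rewrite -(integral_cst P mE); apply: (@le_trans _ _ (\int[P]_(w in E) (f w)%:E)%E).
    apply: ge0_le_integral => //.
    - by move=> w _; rewrite lee_fin expR_ge0.
    - by apply/measurable_EFinP; exact: measurable_funTS.
    - by move=> w Ew; rewrite lee_fin fE ler_expR ler_wpM2l.
  apply: ge0_subset_integral => //; first exact/measurable_EFinP.
  by move=> w _; rewrite lee_fin.
have h2 : (\int[P]_w (f w)%:E = ((1 + c * p) ^+ n)%:E)%E.
  rewrite -[RHS](_ : ((1 + c * p) ^+ n * p ^+ size ([::] : seq nat))%:E = _); last first.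
    by rewrite expr0 mulr1.
  rewrite -(integral_prod_indep A)//; congr integral.
  by apply/seteqP; split.
have h3 : (1 + c * p) ^+ n <= expR (n%:R * (p * (l + 2 * l ^+ 2))).
  rewrite expRM_natl lerXn2r ?nnegrE ?expR_ge0//.
    by rewrite addr_ge0// mulr_ge0.
  apply: le_trans (expR_ge1Dx _); rewrite lerD2l mulrC ler_wpM2l//.
  have := @expR_le_quadratic l; rewrite l0 l1 /c => /(_ isT); lra.
rewrite -(@lee_pmul2l _ a%:E) ?lte_fin ?expR_gt0//.
apply: (le_trans h1); rewrite h2 -EFinM lee_fin -expRD.
apply: (le_trans h3); rewrite ler_expR /l.
have n0 : 0 <= n%:R :> R by [].
(* With [l = t / 4] the exponent is [n * (t^2 * p / 8 - t^2 / 4)]; it exceeds the claimed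
   [- n * t^2 / 8] by [- n * t^2 * (1 - p) / 8], which is nonpositive. *)
have : 0 <= n%:R * (t ^+ 2 * (1 - p)) by rewrite !mulr_ge0// ?exprn_ge0// subr_ge0.
by lra.
Qed.

End hoeffding.

(** * Deviation of the bivariate empirical distribution function at one point *)

Section concentration.
Context {R : realType} {d : measure_display} {Omega : measurableType d}.
Variable P : probability Omega R.
Variables U V : nat -> Omega -> R.
Hypothesis mU : forall k, measurable_fun setT (U k).
Hypothesis mV : forall k, measurable_fun setT (V k).
Hypothesis iidUV : iid_pairs P U V.

Definition emp_joint (n : nat) (w : Omega) (u v : R) : R :=
  (\sum_(k < n) ((U k w <= u) && (V k w <= v))%:R) / n%:R.

Lemma measurable_pair_event (B : set (R * R)) k : measurable B ->
  measurable [set w | B (U k w, V k w)].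
Proof.
move=> mB; rewrite -[X in measurable X]setTI.
have -> : [set w | B (U k w, V k w)] = (fun w => (U k w, V k w)) @^-1` B by [].
exact: measurable_fun_pair.
Qed.

Lemma iid_pairs_expn (B : set (R * R)) (J : seq nat) :
  measurable B -> uniq J ->
  P [set w | forall k, k \in J -> B (U k w, V k w)] =
    ((fine (P [set w | B (U 0%N w, V 0%N w)])) ^+ size J)%:E.
Proof.
move=> mB uJ; have [indB idB] := iidUV.
rewrite (indB J (fun=> B))// (eq_bigr (fun=> P [set w | B (U 0%N w, V 0%N w)])).
  elim: J {uJ} => [|k J IH]; first by rewrite big_nil expr0.
  rewrite big_cons IH exprS EFinM fineK// fin_num_measure//.
  exact: measurable_pair_event.
by move=> k _; exact: idB.
Qed.

Lemma measurable_count_ge (B : set (R * R)) (a : R) (n : nat) :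
  measurable B ->
  measurable [set w | (a <= \sum_(k < n) \1_[set w | B (U k w, V k w)] w)%R].
Proof.
move=> mB; rewrite -[X in measurable X]setTI.
apply: (measurable_fun_le (f := cst a)) => //.
apply: measurable_sum => k; apply: measurable_indic.
exact: measurable_pair_event.
Qed.

Lemma prob_count_ge (B : set (R * R)) (t : R) (n : nat) :
  measurable B -> 0 <= t <= 2 ->
  (P [set w | (n%:R * (fine (P [set w | B (U 0%N w, V 0%N w)]) + t)
      <= \sum_(k < n) \1_[set w | B (U k w, V k w)] w :> R)%R]
   <= (expR (- (n%:R * t ^+ 2 / 8)))%:E)%E.
Proof.
move=> mB t02; apply: (prob_sum_indic_ge P (fun k => [set w | B (U k w, V k w)])) => //.
- by move=> k; exact: (measurable_pair_event B k mB).
- by move=> J uJ; exact: (iid_pairs_expn B).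
- have mE := measurable_pair_event B 0 mB.
  rewrite fine_ge0//= -lee_fin fineK ?fin_num_measure//.
  exact: probability_le1.
Qed.

Let quadrant (u v : R) : set (R * R) := [set z | z.1 <= u /\ z.2 <= v].

Lemma measurable_quadrant u v : measurable (quadrant u v).
Proof.
rewrite (_ : quadrant u v = `]-oo, u] `*` `]-oo, v]); first exact: measurableX.
by apply/seteqP; split => -[a b]; rewrite /= !in_itv.
Qed.

Lemma emp_jointE n w u v : emp_joint n w u v =
  (\sum_(k < n) \1_[set w | quadrant u v (U k w, V k w)] w) / n%:R.
Proof.
congr (_ / _); apply: eq_bigr => k _; rewrite indicE; congr (_%:R).
apply/esym; have [/andP[h1 h2]|h] := boolP (_ && _); first by rewrite mem_set.
by rewrite memNset//= => -[h1 h2]; move: h; rewrite h1 h2.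
Qed.

Lemma measurable_emp_joint n u v : measurable_fun setT (fun w => emp_joint n w u v).
Proof.
under eq_fun do rewrite emp_jointE.
apply: measurable_funM => //; apply: measurable_sum => k.
by apply: measurable_indic; apply: measurable_pair_event; exact: measurable_quadrant.
Qed.

Lemma measurable_emp_joint_dev n u v t :
  measurable [set w | (t <= `|emp_joint n w u v - joint_df P U V u v|)%R].
Proof.
rewrite -[X in measurable X]setTI.
apply: (measurable_fun_le (f := cst t)) => //.
apply: measurableT_comp => //; apply: measurable_funB => //.
exact: measurable_emp_joint.
Qed.

(** The Chernoff bound controls upper deviations only. A lower deviation of the count in a quadrant
    is an upper deviation of the count in its complement, whence the factor 2. *)
Lemma prob_emp_joint_dev (n : nat) (u v t : R) : (0 < n)%N -> 0 <= t <= 2 ->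
  (P [set w | (t <= `|emp_joint n w u v - joint_df P U V u v|)%R]
   <= (2 * expR (- (n%:R * t ^+ 2 / 8)))%:E)%E.
Proof.
move=> n0 t02; have n0' : 0 < n%:R :> R by rewrite ltr0n.
set B := quadrant u v; have mB : measurable B by exact: measurable_quadrant.
have mBC := measurableC mB.
have mA k := measurable_pair_event B k mB.
have pC : fine (P [set w | (~` B) (U 0%N w, V 0%N w)]) = 1 - joint_df P U V u v.
  rewrite (_ : [set w | _] = ~` [set w | B (U 0%N w, V 0%N w)])//.
  by rewrite probability_setC// fineB// fin_num_measure.
have /(_ n mBC t02) h1 := prob_count_ge (~` B) t.
have /(_ n mB t02) h2 := prob_count_ge B t.
rewrite pC in h1.
apply: (@le_trans _ _ (P ([set w | (n%:R * (joint_df P U V u v + t)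
      <= \sum_(k < n) \1_[set w | B (U k w, V k w)] w)%R] `|`
   [set w | (n%:R * (1 - joint_df P U V u v + t)
      <= \sum_(k < n) \1_[set w | (~` B) (U k w, V k w)] w)%R]))); last first.
  apply: le_trans (measureU2 _ _ _) _; [exact: measurable_count_ge..|].
  by rewrite -[2]/(1 + 1) mulrDl mul1r EFinD leeD.
apply: le_measure; rewrite ?inE.
- exact: measurable_emp_joint_dev.
- by apply: measurableU; exact: measurable_count_ge.
move=> w /=; rewrite emp_jointE -/B.
have -> : \sum_(k < n) \1_[set w | (~` B) (U k w, V k w)] w =
   n%:R - \sum_(k < n) \1_[set w | B (U k w, V k w)] w :> R.
  apply/eqP; rewrite eq_sym subr_eq -big_split/=.
  rewrite (eq_bigr (fun=> 1)) ?sumr_const ?card_ord// => k _.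
  rewrite (_ : [set w | (~` B) _] = ~` [set w | B (U k w, V k w)])//.
  by rewrite indicC indicE /=; case: (_ \in _) => /=; rewrite ?add0r ?addr0.
set S := \sum_(k < n) _.
set r := S / n%:R; have SE : S = n%:R * r by rewrite mulrC divfK// gt_eqF.
have -> : n%:R - S = n%:R * (1 - r) by rewrite SE; ring.
rewrite {}SE !ler_pM2l//.
case: (lerP 0 (r - joint_df P U V u v)) => h; rewrite ?(ger0_norm h) ?(ltr0_norm h) => ht.
  by left; lra.
by right; lra.
Qed.

End concentration.

(** * A Borel-Cantelli criterion and the decay that feeds it *)

Section borel_cantelli_bound.
Context {R : realType} {d : measure_display} {Omega : measurableType d}.
Variable P : probability Omega R.

Lemma sum_inv_pronic (m : nat) :
  \sum_(0 <= i < m) (i.+1%:R * i.+2%:R)^-1 = 1 - m.+1%:R^-1 :> R.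
Proof.
rewrite (telescope_sumr_eq (fun k => - k.+1%:R^-1)) ?invr1 ?opprK 1?addrC//.
move=> k _; rewrite -!natr1.
have k0 : 0 <= k%:R :> R by [].
by field; apply/andP; split; rewrite gt_eqF//; lra.
Qed.

(** The majorant [1 / ((n + 1) * (n + 2))] is chosen because its partial sums telescope, so the
    series of probabilities is bounded by [C] itself. *)
Lemma ae_eventually_notin (F : nat -> set Omega) (C : R) :
  (forall n, measurable (F n)) ->
  (forall n, (P (F n) <= (C / (n.+1%:R * n.+2%:R))%:E)%E) ->
  {ae P, forall w, \forall n \near \oo, ~ F n w}.
Proof.
move=> mF leF.
have C0 : 0 <= C.
  have := le_trans (measure_ge0 P (F 0%N)) (leF 0%N).
  by rewrite lee_fin pmulr_lge0// invr_gt0 mul1r.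
have S0 : (\sum_(n <oo) P (F n) < +oo)%E.
  apply: (@le_lt_trans _ _ C%:E); last exact: ltry.
  apply: lime_le; first exact: is_cvg_nneseries.
  near=> m; apply: (@le_trans _ _ (\sum_(0 <= i < m) (C / (i.+1%:R * i.+2%:R))%:E)%E).
    by apply: lee_sum => i _; exact: leF.
  rewrite sumEFin lee_fin -mulr_sumr sum_inv_pronic.
  by rewrite ler_piMr// gerBl invr_ge0.
exists (lim_sup_set F); split.
- by apply: bigcapT_measurable => n; exact: bigcup_measurable.
- exact: lim_sup_set_cvg0.
- move=> w; apply: contra_notP => /= nlim; move: nlim.
  rewrite /lim_sup_set => /existsNP[m /not_implyP[_ hm]].
  exists m => // n /= mn Fnw; apply: hm; exists n => //.
Unshelve. all: by end_near.
Qed.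

(** With [m = n + 1], the term of degree [k + 1] in the exponential series gives
    [exp (m^a / 8) >= m^4 / K] once [a * (k + 1) >= 4]. Two powers of [m] pay for the grid points
    and two for summability. The constant is [36 = 2 * 9 * 2], from [(m + 2)^2 <= 9 m^2] and
    [m * (m + 1) <= 2 m^2]. *)
Lemma expR_powR_decay (a : R) : 0 < a -> exists C : R, forall n : nat,
  n.+3%:R ^+ 2 * (2 * expR (- (n.+1%:R `^ a / 8))) <= C / (n.+1%:R * n.+2%:R).
Proof.
move=> a0; have [k ak] : exists k : nat, 4 <= a * k.+1%:R.
  exists (Num.bound (4 / a)).
  have : 4 / a < (Num.bound (4 / a))%:R by apply: archi_boundP; rewrite divr_ge0// ltW.
  rewrite ltr_pdivrMr// mulrC => h; apply: (le_trans (ltW h)).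
  by rewrite ler_pM2l// ler_nat.
pose K : R := k.+1`!%:R * 8 ^+ k.+1.
exists (36 * K) => n; set m : R := n.+1%:R.
have m1 : 1 <= m by rewrite ler1n.
have m0 : 0 < m by exact: lt_le_trans m1.
have -> : n.+2%:R = m + 1 :> R by rewrite natr1.
have -> : n.+3%:R = m + 2 :> R by rewrite -natrD addnC.
set e := expR _; have e0 : 0 < e by exact: expR_gt0.
have hK : e * m ^+ 4 <= K.
  set z := m `^ a / 8; have z0 : 0 <= z by rewrite divr_ge0// powR_ge0.
  have := expR_ge1Dxn k z0; set E := expR z => hE.
  have E0 : 0 < E by exact: expR_gt0.
  have {}hE : z ^+ k.+1 / k.+1`!%:R <= E by apply: le_trans hE; rewrite lerDr.
  have zk : m ^+ 4 <= z ^+ k.+1 * 8 ^+ k.+1.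
    rewrite -exprMn /z divfK// -[leRHS]powR_mulrn ?powR_ge0// -powRrM.
    by rewrite -(powR_mulrn 4 (ltW m0)) ler_powR.
  rewrite /e expRN -/E mulrC ler_pdivrMr//.
  apply: (le_trans zk); rewrite /K [leRHS]mulrAC; apply: ler_wpM2r; first exact: exprn_ge0.
  by rewrite mulrC -ler_pdivrMr// ltr0n fact_gt0.
rewrite ler_pdivlMr; last by rewrite mulr_gt0//; lra.
have : (m + 2) ^+ 2 * (m * (m + 1)) <= 18 * m ^+ 4.
  have h1 : (m + 2) ^+ 2 <= 9 * m ^+ 2 by nra.
  have h2 : m * (m + 1) <= 2 * m ^+ 2 by nra.
  have -> : 18 * m ^+ 4 = (9 * m ^+ 2) * (2 * m ^+ 2) by ring.
  by apply: ler_pM => //; [exact: sqr_ge0|rewrite mulr_ge0//; lra].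
move=> /(ler_wpM2r (ltW e0)) h; lra.
Qed.

End borel_cantelli_bound.

(** * Uniform law of large numbers with a rate, on the unit square *)

Section uniform_lln.
Context {R : realType} {d : measure_display} {Omega : measurableType d}.
Variable P : probability Omega R.
Variables U V : nat -> Omega -> R.
Hypothesis mU : forall k, measurable_fun setT (U k).
Hypothesis mV : forall k, measurable_fun setT (V k).
Hypothesis iidUV : iid_pairs P U V.
Hypothesis U01 : forall k w, 0 <= U k w <= 1.
Hypothesis V01 : forall k w, 0 <= V k w <= 1.
Hypothesis lipUV : forall u v u' v', `|joint_df P U V u v - joint_df P U V u' v'|
  <= `|u - u'| + `|v - v'|.

Lemma ler_emp_joint n w u u' v v' : u <= u' -> v <= v' ->
  emp_joint U V n w u v <= emp_joint U V n w u' v'.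
Proof.
move=> uu vv; rewrite ler_wpM2r ?invr_ge0//; apply: ler_sum => k _.
rewrite ler_nat; case: (leP (U k w) u) => // hu; case: (leP (V k w) v) => // hv.
by rewrite (le_trans hu)// (le_trans hv).
Qed.

(** Both functions are monotone, so the value at a point lies between those at the lower and upper
    corners of its cell; each corner is within [1 / n] in each coordinate, and the Lipschitz bound
    turns this into [2 / n]. *)
Lemma emp_joint_grid (n : nat) (w : Omega) (t : R) : (0 < n)%N -> 0 <= t ->
  (forall i j, (i < n.+2)%N -> (j < n.+2)%N ->
    `|emp_joint U V n w (i%:R / n%:R) (j%:R / n%:R)
      - joint_df P U V (i%:R / n%:R) (j%:R / n%:R)| <= t) ->
  forall u v, `|emp_joint U V n w u v - joint_df P U V u v| <= t + 2 / n%:R.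
Proof.
move=> n0 t0 grid u v.
have n0' : 0 < n%:R :> R by rewrite ltr0n.
have n'0 : 0 < n%:R^-1 :> R by rewrite invr_gt0.
(* Since [U k <= 1], both functions are constant in [u] beyond 1; below 0 both vanish. This leaves
   only the unit square. *)
wlog u1 : u / u <= 1.
  move=> h; case: (leP u 1) => [/h//|/ltW u1].
  have -> : emp_joint U V n w u v = emp_joint U V n w 1 v.
    congr (_ / _); apply: eq_bigr => k _; have /andP[_ U1] := U01 k w.
    by rewrite U1 (le_trans U1).
  have -> : joint_df P U V u v = joint_df P U V 1 v.
    congr (fine (P _)); apply/seteqP; split => w' [/= _ Vv]; split=> //;
      have /andP[_ U1] := U01 0%N w' => //; exact: le_trans U1 u1.
  exact: h.
wlog v1 : v / v <= 1.
  move=> h; case: (leP v 1) => [/h//|/ltW v1].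
  have -> : emp_joint U V n w u v = emp_joint U V n w u 1.
    congr (_ / _); apply: eq_bigr => k _; have /andP[_ V1] := V01 k w.
    by rewrite V1 (le_trans V1).
  have -> : joint_df P U V u v = joint_df P U V u 1.
    congr (fine (P _)); apply/seteqP; split => w' [/= Uu _]; split=> //;
      have /andP[_ V1] := V01 0%N w' => //; exact: le_trans V1 v1.
  exact: h.
have tn0 : 0 <= t + 2 / n%:R by rewrite addr_ge0// divr_ge0.
have [u0|u0] := ltP u 0.
  have -> : emp_joint U V n w u v = 0.
    rewrite /emp_joint big1 ?mul0r// => k _; have /andP[U0 _] := U01 k w.
    by rewrite leNgt (lt_le_trans u0).
  have -> : joint_df P U V u v = 0.
    rewrite /joint_df (_ : [set w | _] = set0) ?measure0//.
    apply/seteqP; split => // w' [/= Uu _]; have /andP[U0 _] := U01 0%N w'; lra.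
  by rewrite subrr normr0.
have [v0|v0] := ltP v 0.
  have -> : emp_joint U V n w u v = 0.
    rewrite /emp_joint big1 ?mul0r// => k _; have /andP[V0 _] := V01 k w.
    by rewrite andbC leNgt (lt_le_trans v0).
  have -> : joint_df P U V u v = 0.
    rewrite /joint_df (_ : [set w | _] = set0) ?measure0//.
    apply/seteqP; split => // w' [/= _ Vv]; have /andP[V0 _] := V01 0%N w'; lra.
  by rewrite subrr normr0.
(* For [z = 1] the truncation is [n], so the right end of the cell is [(n + 1) / n]: this is why the
   grid has indices up to [n + 1]. *)
have cell (z : R) : 0 <= z -> z <= 1 -> exists i : nat, [/\ (i < n.+1)%N,
    i%:R / n%:R <= z, z <= i.+1%:R / n%:R & i.+1%:R / n%:R = i%:R / n%:R + n%:R^-1 :> R].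
  move=> z0 z1; exists (Num.truncn (n%:R * z)).
  have /andP[h1 h2] := truncn_itv (mulr_ge0 (ltW n0') z0); split.
  - rewrite ltnS -(ler_nat R); apply: (le_trans h1).
    by rewrite ger_pMr.
  - by rewrite ler_pdivrMr// [z * _]mulrC.
  - by rewrite ler_pdivlMr// [z * _]mulrC ltW.
  - by rewrite -natr1 mulrDl mul1r.
have [i [ilt iu ui iS]] := cell u u0 u1.
have [j [jlt jv vj jS]] := cell v v0 v1.
have c1 := ler_emp_joint n w _ _ _ _ iu jv.
have c2 := ler_emp_joint n w _ _ _ _ ui vj.
have := grid i j (leqW ilt) (leqW jlt).
have := grid i.+1 j.+1 ilt jlt.
have := lipUV u v (i%:R / n%:R) (j%:R / n%:R).
rewrite (ger0_norm (_ : 0 <= u - _)) ?subr_ge0//.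
rewrite (ger0_norm (_ : 0 <= v - _)) ?subr_ge0//.
have := lipUV (i.+1%:R / n%:R) (j.+1%:R / n%:R) u v.
rewrite (ger0_norm (_ : 0 <= _ - u)) ?subr_ge0//.
rewrite (ger0_norm (_ : 0 <= _ - v)) ?subr_ge0//.
rewrite !ler_norml => /andP[b1 b2] /andP[b3 b4] /andP[a1 a2] /andP[a3 a4].
apply/andP; split; lra.
Qed.

Lemma ae_uniform_lln (b : R) : 0 < b < 1 / 2 ->
  {ae P, forall w, \forall n \near \oo, forall u v : R,
    `|emp_joint U V n w u v - joint_df P U V u v| <= n%:R `^ (- b) + 2 / n%:R}.
Proof.
move=> /andP[b0 b1].
(* The index is shifted: [dev n] concerns samples of size [n + 1], whose grid has [n + 3] indices
   per axis. *)
pose dev n i j := [set w | (n.+1%:R `^ (- b) <=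
  `|emp_joint U V n.+1 w (i%:R / n.+1%:R) (j%:R / n.+1%:R)
   - joint_df P U V (i%:R / n.+1%:R) (j%:R / n.+1%:R)|)%R].
have mdev n i j : measurable (dev n i j) by exact: measurable_emp_joint_dev.
pose row n i := \big[setU/set0]_(j < n.+3) dev n i j.
have mrow n i : measurable (row n i) by exact: bigsetU_measurable.
pose bad n := \big[setU/set0]_(i < n.+3) row n i.
have mbad n : measurable (bad n) by exact: bigsetU_measurable.
(* The Chernoff exponent at [t = m^-b] is [m * t^2 / 8 = m^(1 - 2 b) / 8], which grows because
   [b < 1/2]. *)
have [C hC] := @expR_powR_decay R (1 - 2 * b) ltac:(lra).
have Pbad n : (P (bad n) <= (C / (n.+1%:R * n.+2%:R))%:E)%E.
  have : ((n.+3%:R ^+ 2 * (2 * expR (- (n.+1%:R `^ (1 - 2 * b) / 8))))%:E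
    <= (C / (n.+1%:R * n.+2%:R))%:E)%E by rewrite lee_fin; exact: hC.
  apply: le_trans.
  have t02 : 0 <= n.+1%:R `^ (- b) <= 2.
    rewrite powR_ge0/= powRN; apply: (@le_trans _ _ 1); last by rewrite ler1n.
    rewrite invf_le1 ?powR_gt0//.
    by rewrite -[leLHS](powRr0 n.+1%:R) ler_powR ?ler1n// ltW.
  have hdev i j : (P (dev n i j) <= (2 * expR (- (n.+1%:R `^ (1 - 2 * b) / 8)))%:E)%E.
    apply: le_trans (prob_emp_joint_dev P U V mU mV iidUV _ _ _ _ (ltn0Sn n) t02) _.
    rewrite lee_fin ler_wpM2l// ler_expR lerN2 ler_wpM2r//.
    rewrite powRD; last by rewrite pnatr_eq0/= implybT.
    by rewrite powRr1// ler_wpM2l// mulrC -mulNr powRrM powR_mulrn// powR_ge0.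
  have := @Boole_inequality _ _ _ P (row n) n.+3 (fun i _ => mrow n i).
  move/le_trans; apply.
  set e := 2 * expR _.
  apply: (@le_trans _ _ (\sum_(i < n.+3) (n.+3%:R * e)%:E)%E).
    apply: lee_sum => i _.
    have := @Boole_inequality _ _ _ P (dev n i) n.+3 (fun j _ => mdev n i j).
    move/le_trans; apply.
    apply: (@le_trans _ _ (\sum_(i < n.+3) e%:E)%E).
      by apply: lee_sum => j _; exact: (hdev (nat_of_ord i) (nat_of_ord j)).
    by rewrite sumEFin sumr_const card_ord mulr_natl.
  by rewrite sumEFin sumr_const card_ord lee_fin -[leLHS]mulr_natl mulrA expr2.
have := ae_eventually_notin P bad C mbad Pbad.
apply: filterS => w [m _ hm].
exists m.+1 => // -[//|n] /= mn; have {hm mn} := hm n mn.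
move=> nbad u v; apply: emp_joint_grid => //.
move=> i j ilt jlt; rewrite leNgt; apply/negP => h; apply: nbad.
rewrite /bad -bigcup_mkord; exists i => //.
by rewrite /row -bigcup_mkord; exists j => //; exact: ltW.
Qed.

End uniform_lln.

(** * Layer-cake formulas and convergence of means under uniform integrability *)

Section layer_cake.
Context {R : realType}.
Implicit Types nu : probability R R.
Local Open Scope ereal_scope.

(** Stated for a function [h] on the line, viewed as a random variable under [nu], so that it serves
    both the positive part of the identity and the tail function [clip]. *)
Lemma ge0_layer_cake nu (h : R -> R) : measurable_fun setT h ->
  (forall x, 0 <= h x)%R ->
  \int[nu]_x (h x)%:E =
  \int[lebesgue_measure]_(r in `[0%R, +oo[) nu (h @^-1` `]r, +oo[).
Proof.
move=> mh h0; pose X : {RV nu >-> R} := mfun_Sub (mem_set mh).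
by have := @ge0_expectation_ccdf _ _ _ nu X h0; rewrite expectation_def.
Qed.

Lemma le0_layer_cake nu (h : R -> R) : measurable_fun setT h ->
  (forall x, h x <= 0)%R ->
  \int[nu]_x (h x)%:E =
  - \int[lebesgue_measure]_(r in `]-oo, 0%R[) nu (h @^-1` `]-oo, r]).
Proof.
move=> mh h0; pose X : {RV nu >-> R} := mfun_Sub (mem_set mh).
by have := @le0_expectation_cdf _ _ _ nu X h0; rewrite expectation_def.
Qed.

Lemma measurable_cdf nu : measurable_fun setT (fun r : R => nu `]-oo, r]%classic).
Proof.
pose X : {RV nu >-> R} := mfun_Sub (mem_set (@measurable_id _ R setT)).
exact: (@cdf_measurable _ _ _ nu X).
Qed.

Lemma measurable_ccdf nu : measurable_fun setT (fun r : R => nu `]r, +oo[%classic).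
Proof.
pose X : {RV nu >-> R} := mfun_Sub (mem_set (@measurable_id _ R setT)).
exact: (@ccdf_measurable _ _ _ nu X).
Qed.

Lemma ccdfE nu (r : R) : nu `]r, +oo[%classic = 1 - nu `]-oo, r]%classic.
Proof.
by rewrite -[in LHS]setCitvl probability_setC.
Qed.

End layer_cake.

Section tight_convergence.
Context {R : realType}.
Let leb := @lebesgue_measure R.
Local Open Scope ereal_scope.

(** On a set [D] of infinite measure the bound 1 is not an integrable majorant. It is one on [D]
    within [[-c, c]], where dominated convergence applies; tightness makes the remainders uniformly
    small. *)
Lemma cvg_integral_tight (D : set R) (f_ : nat -> R -> \bar R) (f : R -> \bar R) :
  measurable D ->
  (forall n, measurable_fun D (f_ n)) -> measurable_fun D f ->
  (forall n x, D x -> 0 <= f_ n x <= 1) -> (forall x, D x -> 0 <= f x <= 1) ->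
  (forall x, D x -> f_ ^~ x @ \oo --> f x) ->
  (forall e : R, (0 < e)%R -> exists c : R,
     forall n, \int[leb]_(x in D `\` `[(- c)%R, c]%classic) f_ n x <= e%:E) ->
  \int[leb]_(x in D) f x < +oo /\
  \int[leb]_(x in D) f_ n x @[n --> \oo] --> \int[leb]_(x in D) f x.
Proof.
move=> mD mf_ mf f_01 f01 f_f tight.
have mI c : measurable (D `&` `[(- c)%R, c]%classic) by exact: measurableI.
have mO c : measurable (D `\` `[(- c)%R, c]%classic) by exact: measurableD.
have leI c : leb (D `&` `[(- c)%R, c]%classic) < +oo.
  apply: (@le_lt_trans _ _ (leb `[(- c)%R, c]%classic)).
    by apply: le_measure; rewrite ?inE; [exact: mI|exact: measurable_itv|exact: subIsetr].
  by rewrite /leb lebesgue_measure_itv/=; case: ifP => _; rewrite ?ltry// -EFinB ltry.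
have split g c : measurable_fun D g -> (forall x, D x -> 0 <= g x) ->
    \int[leb]_(x in D) g x = \int[leb]_(x in D `&` `[(- c)%R, c]%classic) g x
      + \int[leb]_(x in D `\` `[(- c)%R, c]%classic) g x.
  move=> mg g0; rewrite -ge0_integral_setU ?setUIDK//.
  - exact: mI.
  - exact: mO.
  - by apply/disj_setPS => x /= [[_ ?] []].
(* Fatou's lemma carries the tail bound over to the limit [f]. *)
have tightf e : (0 < e)%R -> exists c : R,
    (forall n, \int[leb]_(x in D `\` `[(- c)%R, c]%classic) f_ n x <= e%:E) /\
    \int[leb]_(x in D `\` `[(- c)%R, c]%classic) f x <= e%:E.
  move=> e0; have [c hc] := tight e e0; exists c; split => //.
  apply: (@le_trans _ _ (\int[leb]_(x in D `\` `[(- c)%R, c]%classic) limn_einf (f_ ^~ x))).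
    rewrite le_eqVlt; apply/orP; left; apply/eqP; apply: eq_integral => x.
    by rewrite inE => -[Dx _]; rewrite (cvg_limn_einf_sup (f_f x Dx)).1.
  apply: (le_trans (fatou leb (mO c) _ _)).
  - by move=> n; apply: measurable_funS (mf_ n) => //; exact: subDsetl.
  - by move=> n x [Dx _]; have /andP[] := f_01 n x Dx.
  rewrite limn_einf_lim; apply: lime_le; first exact: is_cvg_einfs.
  apply: nearW => n; apply: le_trans (hc n).
  by apply: ereal_inf_lbound; exists n => /=.
have le2c g c : measurable_fun D g -> (forall x, D x -> 0 <= g x <= 1) ->
    \int[leb]_(x in D `&` `[(- c)%R, c]%classic) g x < +oo.
  move=> mg g01; apply: (@le_lt_trans _ _ (\int[leb]_(x in D `&` `[(- c)%R, c]%classic) 1)).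
    apply: ge0_le_integral => //.
    - exact: mI.
    - by move=> x [Dx _]; have /andP[] := g01 x Dx.
    - by apply: measurable_funS mg => //; exact: subIsetl.
    - by move=> x [Dx _]; have /andP[] := g01 x Dx.
  rewrite (integral_cst leb (mI c)) mul1e; exact: leI.
have cvgI c : \int[leb]_(x in D `&` `[(- c)%R, c]%classic) f_ n x @[n --> \oo]
    --> \int[leb]_(x in D `&` `[(- c)%R, c]%classic) f x.
  apply: (@dominated_cvg _ _ _ leb _ (mI c) f_ f (cst 1)) => //.
  - by move=> n; apply: measurable_funS (mf_ n) => //; exact: subIsetl.
  - by move=> x [/f_f].
  - apply/integrableP; split => //.
    rewrite (eq_integral (cst 1)); last by move=> x _ /=; rewrite normr1.
    rewrite (integral_cst leb (mI c)) mul1e; exact: leI.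
  - by move=> n x [Dx _]; have /andP[a b] := f_01 n x Dx; rewrite gee0_abs.
have fin_f_ n : \int[leb]_(x in D) f_ n x < +oo.
  have [c [hc _]] := tightf 1%R ltr01.
  rewrite (split _ c)//; last by move=> x /(f_01 n) /andP[].
  by rewrite lte_add_pinfty ?le2c//; [exact: f_01|exact: le_lt_trans (hc n) (ltry _)].
have fin_f : \int[leb]_(x in D) f x < +oo.
  have [c [_ hc]] := tightf 1%R ltr01.
  rewrite (split _ c)//; last by move=> x /f01 /andP[].
  by rewrite lte_add_pinfty ?le2c//; exact: le_lt_trans hc (ltry _).
split => //.
have g0 g : (forall x, D x -> 0 <= g x <= 1) ->
    forall E, E `<=` D -> 0 <= \int[leb]_(x in E) g x.
  by move=> g01 E ED; apply: integral_ge0 => x /ED /g01 /andP[].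
have fin g : (forall x, D x -> 0 <= g x <= 1) -> measurable_fun D g ->
    \int[leb]_(x in D) g x < +oo -> forall E, measurable E -> E `<=` D ->
    \int[leb]_(x in E) g x \is a fin_num.
  move=> g01 mg gfin E mE ED; rewrite ge0_fin_numE ?g0//.
  apply: le_lt_trans gfin; apply: ge0_subset_integral => //.
  by move=> x /g01 /andP[].
have Ef : \int[leb]_(x in D) f x \is a fin_num by exact: fin.
rewrite -(fineK Ef); apply/fine_cvgP; split.
  by apply: nearW => n; apply: (fin _ (f_01 n) (mf_ n) (fin_f_ n)).
apply/cvgrPdist_le => e e0.
(* One third for the difference on [[-c, c]], one for the tail of [f] and one for the tail of
   [f_ n]. *)
have e3 : (0 < e / 3)%R by rewrite divr_gt0.
have [c [hc_ hc]] := tightf _ e3.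
have ID : D `&` `[(- c)%R, c]%classic `<=` D by exact: subIsetl.
have OD : D `\` `[(- c)%R, c]%classic `<=` D by exact: subDsetl.
have F1 := fin _ f01 mf fin_f _ (mI c) ID.
have F2 := fin _ f01 mf fin_f _ (mO c) OD.
have := cvgI c; rewrite -(fineK F1).
move=> /fine_cvgP[_ /cvgrPdist_le /(_ _ e3)]; apply: filterS => n /=.
have F3 := fin _ (f_01 n) (mf_ n) (fin_f_ n) _ (mI c) ID.
have F4 := fin _ (f_01 n) (mf_ n) (fin_f_ n) _ (mO c) OD.
rewrite (split f c mf); last by move=> x /f01 /andP[].
rewrite (split (f_ n) c (mf_ n)); last by move=> x /(f_01 n) /andP[].
rewrite (fineD F1 F2) (fineD F3 F4).
have : (0 <= fine (\int[leb]_(x in D `\` `[(- c)%R, c]%classic) f x) <= e / 3)%R.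
  by rewrite fine_ge0 ?(g0 _ f01)//= -lee_fin fineK.
have : (0 <= fine (\int[leb]_(x in D `\` `[(- c)%R, c]%classic) f_ n x) <= e / 3)%R.
  by rewrite fine_ge0 ?(g0 _ (f_01 n))//= -lee_fin fineK.
move=> /andP[a1 a2] /andP[b1 b2]; rewrite !ler_norml => /andP[c1 c2].
by apply/andP; split; lra.
Qed.

End tight_convergence.

Section mean_convergence.
Context {R : realType}.
Implicit Types nu : probability R R.
Let leb := @lebesgue_measure R.
Local Open Scope ereal_scope.

(** The integrand of the uniform integrability condition, extended by 0 to the line so that the
    layer-cake formula applies to it. *)
Let clip (c y : R) : R := (if (c < `|y|) then `|y| else 0)%R.

Let clip_ge0 c y : (0 <= clip c y)%R.
Proof. by rewrite /clip; case: ifP. Qed.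

Let measurable_clip c : measurable_fun setT (clip c).
Proof.
apply: measurable_fun_ifT => //.
by apply: measurable_fun_ltr => //; exact: measurableT_comp.
Qed.

Let integral_clip nu c : \int[nu]_x (clip c x)%:E =
  \int[nu]_(x in [set y | (c < `|y|)%R]) (`|x|)%:E.
Proof.
rewrite [RHS]integral_mkcond; apply: eq_integral => y _.
rewrite patchE /clip; case: (ltP c `|y|%R) => h; first by rewrite mem_set.
by rewrite memNset//= ltNge h.
Qed.

(** For [r > c >= 0] the event [y > r] is contained in [clip c y > r]; integrating over [r] and
    applying the layer-cake formula to [clip c] gives the bound. The domain is the half-line beyond
    [c]. *)
Lemma upper_tail_le nu (c : R) : (0 <= c)%R ->
  \int[leb]_(r in `]0%R, +oo[%classic `\` `[(- c)%R, c]%classic) nu `]r, +oo[%classic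
  <= \int[nu]_(x in [set y | (c < `|y|)%R]) (`|x|)%:E.
Proof.
move=> c0; rewrite -integral_clip (ge0_layer_cake _ _ (measurable_clip c) (clip_ge0 c)).
have mclip : measurable_fun setT (fun r : R => nu (clip c @^-1` `]r, +oo[)).
  pose X : {RV nu >-> R} := mfun_Sub (mem_set (measurable_clip c)).
  exact: (@ccdf_measurable _ _ _ nu X).
have mD : measurable (`]0%R, +oo[%classic `\` `[(- c)%R, c]%classic : set R).
  exact: measurableD.
apply: (@le_trans _ _ (\int[leb]_(r in `]0%R, +oo[%classic `\` `[(- c)%R, c]%classic)
    nu (clip c @^-1` `]r, +oo[))).
  apply: ge0_le_integral => //.
  - exact: measurable_funTS (measurable_ccdf nu).
  - exact: measurable_funTS.
  - move=> r [/=]; rewrite in_itv/= andbT => r0 /negP; rewrite in_itv/= => rc.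
    have {}rc : (c < r)%R.
      by rewrite ltNge; apply: contraNN rc => ->; rewrite andbT (le_trans _ (ltW r0))// oppr_le0.
    apply: le_measure; rewrite ?inE//.
      by rewrite -[X in measurable X]setTI; exact: measurable_clip.
    move=> y /=; rewrite !in_itv/= !andbT => ry.
    by rewrite /clip gtr0_norm ?(lt_trans rc ry) ?(lt_trans r0 ry).
apply: ge0_subset_integral => //.
- exact: measurable_funTS.
- move=> r [/=]; rewrite !in_itv/= !andbT => /ltW //.
Qed.

(** Mirror image of [upper_tail_le], through the nonpositive function [- clip c]: for [r < -c], the
    event [y <= r] is contained in [- clip c y <= r]. *)
Lemma lower_tail_le nu (c : R) : (0 <= c)%R ->
  \int[leb]_(r in `]-oo, 0%R[%classic `\` `[(- c)%R, c]%classic) nu `]-oo, r]%classic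
  <= \int[nu]_(x in [set y | (c < `|y|)%R]) (`|x|)%:E.
Proof.
move=> c0; rewrite -integral_clip.
have mN : measurable_fun setT (fun y => - clip c y)%R.
  by apply: measurableT_comp => //; exact: measurable_clip.
have -> : \int[nu]_x (clip c x)%:E =
    \int[leb]_(r in `]-oo, 0%R[) nu ((fun y => - clip c y)%R @^-1` `]-oo, r]).
  apply: oppe_inj; rewrite -(le0_layer_cake _ _ mN); last first.
    by move=> y; rewrite oppr_le0.
  rewrite -integral_ge0N//; last by move=> y _; rewrite lee_fin.
have mclip : measurable_fun setT (fun r : R => nu ((fun y => - clip c y)%R @^-1` `]-oo, r])).
  pose X : {RV nu >-> R} := mfun_Sub (mem_set mN).
  exact: (@cdf_measurable _ _ _ nu X).
have mD : measurable (`]-oo, 0%R[%classic `\` `[(- c)%R, c]%classic : set R).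
  exact: measurableD.
apply: (@le_trans _ _ (\int[leb]_(r in `]-oo, 0%R[%classic `\` `[(- c)%R, c]%classic)
    nu ((fun y => - clip c y)%R @^-1` `]-oo, r]))).
  apply: ge0_le_integral => //.
  - exact: measurable_funTS (measurable_cdf nu).
  - exact: measurable_funTS.
  - move=> r [/=]; rewrite in_itv/= => r0 /negP; rewrite in_itv/= => rc.
    have {}rc : (r < - c)%R.
      by rewrite ltNge; apply: contraNN rc => ->/=; rewrite (le_trans (ltW r0)).
    apply: le_measure; rewrite ?inE//.
      by rewrite -[X in measurable X]setTI; exact: mN.
    move=> y /=; rewrite !in_itv/= => yr.
    rewrite /clip ltr0_norm; last exact: le_lt_trans r0.
    by rewrite ltrNr (le_lt_trans yr rc) opprK.
apply: ge0_subset_integral => //.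
exact: measurable_funTS.
Qed.

Lemma integral_cdf_ccdf nu :
  \int[nu]_y (y%:E) = \int[leb]_(r in `]0%R, +oo[%classic) nu `]r, +oo[%classic
    - \int[leb]_(r in `]-oo, 0%R[%classic) nu `]-oo, r]%classic.
Proof.
rewrite integralE; congr (_ + _).
  (* The layer-cake formula integrates over the closed half-line, the estimator over the open one;
     the point 0 is null. *)
  rewrite integral_itv_obnd_cbnd; last exact: measurable_funTS (measurable_ccdf nu).
  have mp : measurable_fun setT (fun y : R => Num.max y 0%R).
    exact: measurable_funrpos (@measurable_id _ R setT).
  transitivity (\int[nu]_y (Num.max y 0%R)%:E).
    by apply: eq_integral => y _; rewrite funeposE EFin_max.
  rewrite (ge0_layer_cake _ _ mp); last by move=> y; rewrite le_max lexx orbT.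
  apply: eq_integral => r; rewrite inE/= in_itv/= andbT => r0; congr (nu _).
  by apply/seteqP; split => y /=; rewrite !in_itv/= !andbT lt_max (ltNge r 0%R) r0 orbF.
have mn : measurable_fun setT (fun y : R => - Num.max (- y) 0)%R.
  apply: measurableT_comp => //.
  exact: measurable_funrneg (@measurable_id _ R setT).
congr (- _); apply: oppe_inj.
transitivity (\int[nu]_y (- Num.max (- y) 0)%R%:E).
  rewrite -integral_ge0N//.
  by apply: eq_integral => y _; rewrite funenegE EFinN EFin_max EFinN.
rewrite (le0_layer_cake _ _ mn); last by move=> y; rewrite oppr_le0 le_max lexx orbT.
congr (- _); apply: eq_integral => r; rewrite inE/= in_itv/= => r0; congr (nu _).
apply/seteqP; split => y /=; rewrite !in_itv/= lerNl le_max lerN2.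
  by rewrite oppr_le0 [(0 <= r)%R]leNgt r0 orbF.
by move=> ->.
Qed.

Lemma cvg_mean_of_cdf (nu : nat -> probability R R) (nu0 : probability R R) :
  (forall y, nu n `]-oo, y]%classic @[n --> \oo] --> nu0 `]-oo, y]%classic) ->
  (forall e : R, (0 < e)%R -> exists c : R, forall n,
    \int[nu n]_(x in [set y | (c < `|y|)%R]) (`|x|)%:E <= e%:E) ->
  \int[leb]_(y in `]0%R, +oo[%classic) (1 - nu n `]-oo, y]%classic)
    - \int[leb]_(y in `]-oo, 0%R[%classic) nu n `]-oo, y]%classic
  @[n --> \oo] --> \int[nu0]_y (y%:E).
Proof.
move=> cvgnu ui.
(* The threshold may be negative, whereas the tail lemmas require [0 <= c]; raising it to 0 only
   shrinks the tail set. *)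
have {}ui e : (0 < e)%R -> exists2 c : R, (0 <= c)%R & forall n,
    \int[nu n]_(x in [set y | (c < `|y|)%R]) (`|x|)%:E <= e%:E.
  move=> e0; have [c hc] := ui e e0; exists (Num.max c 0%R).
    by rewrite le_max lexx orbT.
  move=> n; apply: le_trans (hc n).
  have mlt a : measurable [set y : R | (a < `|y|)%R].
    rewrite -[X in measurable X]setTI.
    have -> : [set y : R | (a < `|y|)%R] = (fun y : R => `|y|%R) @^-1` `]a, +oo[%classic.
      by apply/seteqP; split => y /=; rewrite in_itv/= andbT.
    exact: normr_measurable.
  apply: ge0_subset_integral => //.
    by apply/measurable_EFinP; exact: normr_measurable.
  by move=> y /=; rewrite gt_max => /andP[].
have cdf01 (m : probability R R) A : measurable A -> 0 <= m A <= 1.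
  by move=> mA; rewrite measure_ge0 probability_le1.
under eq_cvg do under eq_integral do rewrite -ccdfE.
have [finp cvgp] : \int[leb]_(y in `]0%R, +oo[%classic) nu0 `]y, +oo[%classic < +oo /\
    \int[leb]_(y in `]0%R, +oo[%classic) nu n `]y, +oo[%classic @[n --> \oo] -->
    \int[leb]_(y in `]0%R, +oo[%classic) nu0 `]y, +oo[%classic.
  apply: cvg_integral_tight => //.
  - by move=> n; exact: measurable_funTS (measurable_ccdf _).
  - exact: measurable_funTS (measurable_ccdf _).
  - by move=> n x _; exact: cdf01.
  - by move=> x _; exact: cdf01.
  - move=> x _; rewrite ccdfE; under eq_cvg do rewrite ccdfE.
    by apply: cvgeB => //; exact: cvg_cst.
  - move=> e /ui[c c0 hc]; exists c => n.
    exact: le_trans (upper_tail_le _ _ c0) (hc n).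
have [finn cvgn] : \int[leb]_(y in `]-oo, 0%R[%classic) nu0 `]-oo, y]%classic < +oo /\
    \int[leb]_(y in `]-oo, 0%R[%classic) nu n `]-oo, y]%classic @[n --> \oo] -->
    \int[leb]_(y in `]-oo, 0%R[%classic) nu0 `]-oo, y]%classic.
  apply: cvg_integral_tight => //.
  - by move=> n; exact: measurable_funTS (measurable_cdf _).
  - exact: measurable_funTS (measurable_cdf _).
  - by move=> n x _; exact: cdf01.
  - by move=> x _; exact: cdf01.
  - move=> e /ui[c c0 hc]; exists c => n.
    exact: le_trans (lower_tail_le _ _ c0) (hc n).
rewrite integral_cdf_ccdf; apply: cvgeB => //.
(* The limit of the lower integrals is finite, which rules out [oo - oo]. *)
apply: fin_num_adde_defl; rewrite fin_numN ge0_fin_numE//.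
exact: integral_ge0.
Qed.

End mean_convergence.

(** * The checkerboard kernel and bilinear interpolation as convex combinations *)

Section checkerboard.
Context {R : realType}.

Lemma cb_int_exists (N : nat) (u : R) : (0 < N)%N -> 0 <= u <= 1 ->
  exists m : nat, [/\ (m < N)%N, m%:R / N%:R <= u, u <= m.+1%:R / N%:R &
    cb_int N m.+1 u].
Proof.
move=> N0 /andP[u0 u1]; have N0' : 0 < N%:R :> R by rewrite ltr0n.
have exP : exists i : nat, (0 < i)%N && (u <= i%:R / N%:R).
  by exists N; rewrite N0 divff ?gt_eqF.
(* Cells are open on the left, so the index sought is the least positive [i] with [u <= i / N];
   positivity puts [u = 0] into the first, closed cell. *)
case: (ex_minnP exP) => -[//|m] /= ui mmin; exists m.
have mN : (m < N)%N by apply: mmin; rewrite N0 divff ?gt_eqF.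
have um : (m = 0)%N \/ m%:R / N%:R < u.
  case: m {ui mN} mmin => [|m] mmin; first by left.
  right; rewrite ltNge; apply/negP => h.
  by have := mmin m.+1; rewrite h ltnn => /(_ isT).
split => //.
  by case: um => [->|/ltW//]; rewrite mul0r.
rewrite /cb_int; case: um => [m0|um].
  by move: ui; rewrite m0/= in_itv/= u0.
case: ifP => [/eqP[m0]|_] /=; rewrite in_itv/=; last by rewrite -natr1 addrK natr1 um.
by move: ui; rewrite m0 u0.
Qed.

Lemma cb_int_inj (N i j : nat) (u : R) : (0 < N)%N -> (0 < i)%N -> (0 < j)%N ->
  cb_int N i u -> cb_int N j u -> i = j.
Proof.
move=> N0; wlog ij : i j / (i <= j)%N.
  by case: (leqP i j) => [ij H|/ltnW ij H i0 j0 ui uj]; [exact: H|apply/esym/H].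
move=> i0 j0 ui uj; apply/eqP; rewrite eqn_leq ij/= leqNgt; apply/negP => ltij.
have N0' : 0 < N%:R :> R by rewrite ltr0n.
have {ui} : u <= i%:R / N%:R.
  by move: ui; rewrite /cb_int; case: ifP => [/eqP->|_] /=; rewrite in_itv/= => /andP[].
have j1 : (j == 1%N) = false by apply/negbTE; rewrite neq_ltn (leq_trans _ ltij) ?orbT.
move: uj; rewrite /cb_int j1 /= in_itv/= => /andP[uj _].
apply/negP; rewrite -ltNge; apply: le_lt_trans uj.
by rewrite ler_pM2r ?invr_gt0// lerBrDr natr1 ler_nat.
Qed.

Lemma lebesgue_cb_int (N j : nat) (v : R) : (0 < N)%N -> 0 <= v ->
  fine (lebesgue_measure (`[0, v]%classic `&` cb_int N j.+1)) =
  Num.max 0 (Num.min v (j.+1%:R / N%:R) - j%:R / N%:R).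
Proof.
move=> N0 v0; have N0' : 0 < N%:R :> R by rewrite ltr0n.
have j0 : 0 <= j%:R / N%:R :> R by rewrite divr_ge0.
have len (a b : R) : fine (if (a < b)%R then b%:E - a%:E else 0)%E = Num.max 0 (b - a).
  by case: ltP => ab /=; rewrite /Num.max; case: ltP; lra.
rewrite /cb_int; case: ifP => [/eqP[->]|_].
  rewrite (_ : _ `&` _ = `[0, Num.min v (1 / N%:R)]%classic); last first.
    apply/seteqP; split => z /=; rewrite !in_itv/= le_min.
      by case=> /andP[-> ->] /andP[_ ->].
    by move=> /and3P[-> -> ->].
  by rewrite lebesgue_measure_itv/= lte_fin len mul0r.
rewrite (_ : _ `&` _ = `]j%:R / N%:R, Num.min v (j.+1%:R / N%:R)]%classic); last first.
  rewrite -natr1 addrK; apply/seteqP; split => z /=; rewrite !in_itv/= le_min.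
    by case=> /andP[_ ->] /andP[-> ->].
  by move=> /and3P[h -> ->]; rewrite h (le_trans j0 (ltW h)).
by rewrite lebesgue_measure_itv/= lte_fin len.
Qed.

(** In the column of [u], cells entirely below [v] contribute [(g (j + 1) - g j) / N], which
    telescopes; the cell of [v] contributes a fraction [t] of its mass, and cells above contribute
    nothing. The term [g 0] remains because [B] is an arbitrary function here. *)
Lemma cb_kernelE (B : R -> R -> R) (N l m : nat) (u v : R) :
  (l < N)%N -> (m < N)%N -> cb_int N l.+1 u ->
  0 <= v -> m%:R / N%:R <= v -> v <= m.+1%:R / N%:R ->
  let g (j : nat) := B (l.+1%:R / N%:R) (j%:R / N%:R) - B (l%:R / N%:R) (j%:R / N%:R) in
  let t := N%:R * v - m%:R in
  cb_kernel B N u v = N%:R * ((1 - t) * g m + t * g m.+1 - g 0%N).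
Proof.
move=> lN mN ul v0 mv vm g t.
have N0 : (0 < N)%N by exact: leq_ltn_trans lN.
have N0' : 0 < N%:R :> R by rewrite ltr0n.
have N0'' : N%:R != 0 :> R by rewrite gt_eqF.
rewrite /cb_kernel (bigD1_seq l.+1) ?iota_uniq ?mem_index_iota//=.
rewrite [X in _ * (_ + X) = _]big1_seq ?addr0; last first.
  move=> i /andP[il]; rewrite mem_index_iota => /andP[i0 _].
  apply: big1 => j _; rewrite indicE memNset ?mulr0 ?mul0r// => ui.
  by move/eqP: il; apply; exact: cb_int_inj ui ul.
have -> : \sum_(1 <= j < N.+1) cb_mass B N l.+1 j * \1_(cb_int N l.+1) u *
    fine (lebesgue_measure (`[0, v]%classic `&` cb_int N j)) =
  \sum_(0 <= j < N) (g j.+1 - g j) *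
     Num.max 0 (Num.min v (j.+1%:R / N%:R) - j%:R / N%:R).
  rewrite big_add1/=; apply: eq_bigr => j _.
  rewrite lebesgue_cb_int// indicE mem_set// mulr1; congr (_ * _).
  have predS i : i.+1%:R - 1 = i%:R :> R by rewrite -natr1 addrK.
  by rewrite /cb_mass /g !predS; ring.
rewrite (big_cat_nat _ (n := m))//=; last exact: ltnW.
rewrite [X in _ + X]big_ltn//.
have -> : \sum_(m.+1 <= j < N) (g j.+1 - g j) *
     Num.max 0 (Num.min v (j.+1%:R / N%:R) - j%:R / N%:R) = 0.
  rewrite big_nat_cond big1// => j /andP[/andP[mj _] _].
  rewrite (min_idPl _); last first.
    by apply: (le_trans vm); rewrite ler_pM2r ?invr_gt0// ler_nat ltnW.
  rewrite (max_idPl _) ?mulr0// subr_le0.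
  by apply: (le_trans vm); rewrite ler_pM2r ?invr_gt0// ler_nat.
rewrite addr0.
have -> : \sum_(0 <= j < m) (g j.+1 - g j) *
     Num.max 0 (Num.min v (j.+1%:R / N%:R) - j%:R / N%:R) = (g m - g 0%N) / N%:R.
  rewrite -(telescope_sumr g (leq0n m)) mulr_suml.
  rewrite big_nat_cond [RHS]big_nat_cond; apply: eq_bigr => j /andP[/andP[_ jm] _].
  congr (_ * _); rewrite (min_idPr _); last first.
    by apply: le_trans mv; rewrite ler_pM2r ?invr_gt0// ler_nat.
  rewrite -mulrBl -natr1 addrAC subrr add0r mul1r (max_idPr _)//.
rewrite (min_idPl _)// (max_idPr _) ?subr_ge0// /t.
by field.
Qed.

(** Each column increment of [B] differs from that of [A] by at most [2 e]. Two such errors occur,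
    one in the convex combination and one in [gB 0], where the increment of [A] vanishes; the factor
    [N] then gives [4 N e]. The slopes of [A] are constrained only in columns meeting [u] and on
    grid lines within [1/N] of [v]. *)
Lemma cb_kernel_close (A B : R -> R -> R) (N : nat) (u v kappa e h : R) :
  (0 < N)%N -> 0 <= u <= 1 -> 0 <= v <= 1 ->
  (forall u' v' : R, 0 <= u' <= 1 -> 0 <= v' <= 1 -> `|B u' v' - A u' v'| <= e) ->
  (forall u' : R, 0 <= u' <= 1 -> A u' 0 = 0) ->
  (forall l m : nat, (l < N)%N -> (m <= N)%N ->
    l%:R / N%:R <= u <= l.+1%:R / N%:R -> `|m%:R / N%:R - v| <= N%:R^-1 ->
    `|N%:R * (A (l.+1%:R / N%:R) (m%:R / N%:R) - A (l%:R / N%:R) (m%:R / N%:R))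
      - kappa| <= h) ->
  `|cb_kernel B N u v - kappa| <= 4 * (N%:R * e) + h.
Proof.
move=> N0 u01 v01 BA A0 inc; have N0' : 0 < N%:R :> R by rewrite ltr0n.
have N0'' : N%:R != 0 :> R by rewrite gt_eqF.
have [l [lN lu ul cbl]] := cb_int_exists N u N0 u01.
have [m [mN mv vm _]] := cb_int_exists N v N0 v01.
have /andP[v0 v1] := v01.
pose t := N%:R * v - m%:R.
pose gB (j : nat) := B (l.+1%:R / N%:R) (j%:R / N%:R) - B (l%:R / N%:R) (j%:R / N%:R).
pose gA (j : nat) := A (l.+1%:R / N%:R) (j%:R / N%:R) - A (l%:R / N%:R) (j%:R / N%:R).
have -> : cb_kernel B N u v = N%:R * ((1 - t) * gB m + t * gB m.+1 - gB 0%N).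
  exact: cb_kernelE.
have t0 : 0 <= t by rewrite subr_ge0 -ler_pdivrMl// mulrC.
have t1 : t <= 1 by rewrite lerBlDl natr1 -ler_pdivlMl// mulrC.
have grid (i : nat) : (i <= N)%N -> 0 <= (i%:R / N%:R : R) <= 1.
  by move=> iN; rewrite divr_ge0//= ler_pdivrMr// mul1r ler_nat.
have gBA (j : nat) : (j <= N)%N -> `|gB j - gA j| <= 2 * e.
  move=> jN; have := BA _ _ (grid _ lN) (grid _ jN).
  have := BA _ _ (grid _ (ltnW lN)) (grid _ jN).
  rewrite /gB /gA !ler_norml => /andP[a1 a2] /andP[a3 a4].
  by apply/andP; split; lra.
have gA0 : gA 0%N = 0.
  by rewrite /gA mul0r !A0 ?subrr//; apply: grid => //; exact: ltnW.
have gAm (j : nat) : (j <= N)%N -> `|j%:R / N%:R - v| <= N%:R^-1 ->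
    `|N%:R * gA j - kappa| <= h.
  by move=> jN jv; apply: inc => //; rewrite lu.
have hm : m.+1%:R / N%:R = m%:R / N%:R + N%:R^-1 :> R.
  by rewrite -natr1 mulrDl mul1r.
have i0 : 0 <= N%:R^-1 :> R by rewrite invr_ge0.
have am : `|N%:R * gA m - kappa| <= h.
  by apply: gAm; [exact: ltnW|rewrite ler_norml; apply/andP; split; lra].
have am1 : `|N%:R * gA m.+1 - kappa| <= h.
  by apply: gAm => //; rewrite ler_norml; apply/andP; split; lra.
have bm := gBA _ (ltnW mN); have bm1 := gBA _ mN.
have := gBA _ (leq0n N); rewrite gA0 subr0 => b0.
have -> : N%:R * ((1 - t) * gB m + t * gB m.+1 - gB 0%N) - kappa =
  (1 - t) * (N%:R * gA m - kappa) + t * (N%:R * gA m.+1 - kappa)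
  + N%:R * ((1 - t) * (gB m - gA m) + t * (gB m.+1 - gA m.+1) - gB 0%N) by ring.
have conv (x y c : R) : `|x| <= c -> `|y| <= c -> `|(1 - t) * x + t * y| <= c.
  move=> hx hy; apply: le_trans (ler_normD _ _) _; rewrite !normrM.
  by rewrite (ger0_norm t0) ger0_norm ?subr_ge0//; nra.
apply: le_trans (ler_normD _ _) _; rewrite addrC lerD ?conv//.
rewrite normrM gtr0_norm//.
have -> : 4 * (N%:R * e) = N%:R * (2 * e + 2 * e) by ring.
rewrite ler_pM2l//; apply: le_trans (ler_normB _ _) _.
by rewrite lerD// conv.
Qed.

(** The interpolation is a convex combination of four corner values of [E]. Every corner is within
    [1 / n] of [(u, v)] in each coordinate, so each value is within [e + 2 / n] of [J u v]. *)
Lemma bilin_interp_close (E J : R -> R -> R) (n : nat) (u v e : R) :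
  (0 < n)%N -> u <= 1 -> v <= 1 ->
  (forall u v, `|E u v - J u v| <= e) ->
  (forall u v u' v', `|J u v - J u' v'| <= `|u - u'| + `|v - v'|) ->
  `|bilin_interp E n u v - J u v| <= e + 2 / n%:R.
Proof.
move=> n0 u1 v1 EJ lipJ; have n0' : 0 < n%:R :> R by rewrite ltr0n.
(* The cap [n - 1] takes effect at [z = 1], where the floor would be [n]; the weight is then exactly
   1. *)
have cell (z p : R) : z <= 1 ->
    p = Num.min (Num.floor (n%:R * z))%:~R (n%:R - 1) -> 0 <= n%:R * z - p <= 1.
  move=> z1 ->; rewrite subr_ge0 lerBlDl.
  have /andP[f1 f2] := floor_itv (n%:R * z).
  rewrite ge_min f1/=; case: (leP (Num.floor (n%:R * z))%:~R (n%:R - 1)) => _.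
    by move: f2; rewrite intrD => /ltW.
  by rewrite subrK ger_pMr.
rewrite /bilin_interp.
set p := Num.min (Num.floor (n%:R * u))%:~R _.
set q := Num.min (Num.floor (n%:R * v))%:~R _.
have := cell u p u1 erefl; have := cell v q v1 erefl.
set a := n%:R * u - p; set b := n%:R * v - q.
move=> /andP[b0 b1] /andP[a0 a1].
have near (z c : R) : 0 <= n%:R * z - c <= 1 ->
    `|c / n%:R - z| <= n%:R^-1 /\ `|(c + 1) / n%:R - z| <= n%:R^-1.
  move=> /andP[z0 z1]; have -> : z = (n%:R * z) / n%:R.
    by rewrite mulrAC divff ?mul1r// gt_eqF.
  have i0 : 0 < n%:R^-1 :> R by rewrite invr_gt0.
  rewrite -!mulrBl !normrM (gtr0_norm i0) !ler_piMl ?(ltW i0)// ler_norml;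
    by apply/andP; split; lra.
have [u2 u3] := near u p ltac:(by rewrite a0).
have [v2 v3] := near v q ltac:(by rewrite b0).
have corner (x y : R) : `|x - u| <= n%:R^-1 -> `|y - v| <= n%:R^-1 ->
    `|E x y - J u v| <= e + 2 / n%:R.
  move=> hx hy; have -> : E x y - J u v = (E x y - J x y) + (J x y - J u v) by ring.
  apply: le_trans (ler_normD _ _) _; apply: lerD => //.
  by apply: le_trans (lipJ _ _ _ _) _; lra.
set c := e + _ in corner *.
have h1 := corner _ _ u2 v2; have h2 := corner _ _ u3 v2.
have h3 := corner _ _ u2 v3; have h4 := corner _ _ u3 v3.
move: h1 h2 h3 h4; set x1 := E _ _; set x2 := E _ _; set x3 := E _ _; set x4 := E _ _.
move=> h1 h2 h3 h4.
have conv (t x y : R) : 0 <= t -> t <= 1 -> `|x - J u v| <= c -> `|y - J u v| <= c ->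
    `|((1 - t) * x + t * y) - J u v| <= c.
  move=> t0 t1 hx hy.
  have -> : (1 - t) * x + t * y - J u v = (1 - t) * (x - J u v) + t * (y - J u v) by ring.
  apply: le_trans (ler_normD _ _) _; rewrite !normrM.
  by rewrite (ger0_norm t0) ger0_norm ?subr_ge0//; nra.
have -> : (1 - a) * (1 - b) * x1 + a * (1 - b) * x2 + (1 - a) * b * x3 + a * b * x4
  = (1 - b) * ((1 - a) * x1 + a * x2) + b * ((1 - a) * x3 + a * x4) by ring.
apply: (conv b) => //.
  by have := conv a x1 x2 a0 a1 h1 h2.
by have := conv a x3 x4 a0 a1 h3 h4.
Qed.

End checkerboard.

(** * From the transformed sample back to empirical marginals and ranks *)

Section empirical_subcopula.
Context {R : realType} {d : measure_display} {Omega : measurableType d}.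
Implicit Types (X Y : nat -> Omega -> R) (F G : R -> R).

(** [X k <= x] implies [F (X k) <= F x], but the converse fails where [F] is flat. Instead
    [F (X k) <= F x - e] forces [X k <= x]; the Lipschitz bound on [c] charges [e] for the shift,
    and [e] is arbitrary. *)
Lemma emp_df_transform X F (c : R -> R) (n : nat) (w : Omega) (D : R) :
  nondecreasing_fun F ->
  (forall u, `|emp_df (fun k w => F (X k w)) n w u - c u| <= D) ->
  (forall u u', `|c u - c u'| <= `|u - u'|) -> (forall x, c (F x) = F x) ->
  forall x, `|emp_df X n w x - F x| <= D.
Proof.
move=> ndF hD lipc cF x; apply/ler_addgt0Pr => e e0.
have mono (p q : pred nat) : (forall k, p k -> q k) ->
    (\sum_(k < n) (p k)%:R) / n%:R <= (\sum_(k < n) (q k)%:R) / n%:R :> R.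
  move=> pq; rewrite ler_wpM2r ?invr_ge0//; apply: ler_sum => k _.
  by rewrite ler_nat; case: (boolP (p k)) => // /pq ->.
have up : emp_df X n w x <= emp_df (fun k w => F (X k w)) n w (F x).
  by apply: (mono (fun k => X k w <= x) (fun k => F (X k w) <= F x)) => k; exact: ndF.
have lo : emp_df (fun k w => F (X k w)) n w (F x - e) <= emp_df X n w x.
  apply: (mono (fun k => F (X k w) <= F x - e) (fun k => X k w <= x)) => k h.
  rewrite leNgt; apply/negP => /ltW/ndF h'; lra.
have := hD (F x); have := hD (F x - e); have := lipc (F x - e) (F x).
rewrite cF addrAC subrr add0r normrN (gtr0_norm e0) !ler_norml.
by move=> /andP[a1 a2] /andP[a3 a4] /andP[a5 a6]; apply/andP; split; lra.
Qed.

(** The normalized rank of [X k] is within [D] of [F (X k)], so the subcopula lies between the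
    empirical distribution function at [(u - D, v - D)] and at [(u + D, v + D)]. The shift costs
    [2 D] by the Lipschitz bound, the approximation another [D]. *)
Lemma emp_subcop_close X Y F G (J : R -> R -> R) (n : nat) (w : Omega) (D : R) :
  (forall u v, `|emp_joint (fun k w => F (X k w)) (fun k w => G (Y k w)) n w u v
     - J u v| <= D) ->
  (forall u v u' v', `|J u v - J u' v'| <= `|u - u'| + `|v - v'|) ->
  (forall x, `|emp_df X n w x - F x| <= D) ->
  (forall y, `|emp_df Y n w y - G y| <= D) ->
  forall u v, `|emp_subcop X Y n w u v - J u v| <= 3 * D.
Proof.
move=> hD lipJ hX hY u v.
have D0 : 0 <= D by exact: le_trans (normr_ge0 _) (hD u v).
set U := fun k w => F (X k w) in hD *; set V := fun k w => G (Y k w) in hD *.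
have lo : emp_joint U V n w (u - D) (v - D) <= emp_subcop X Y n w u v.
  rewrite ler_wpM2r ?invr_ge0//; apply: ler_sum => k _; rewrite ler_nat.
  case: (boolP (_ && _)) => // /andP[h1 h2]; rewrite lt0b.
  move: (hX (X k w)) (hY (Y k w)) h1 h2; rewrite /U /V !ler_norml.
  by move=> /andP[_ a1] /andP[_ a2] h1 h2; apply/andP; split; lra.
have up : emp_subcop X Y n w u v <= emp_joint U V n w (u + D) (v + D).
  rewrite ler_wpM2r ?invr_ge0//; apply: ler_sum => k _; rewrite ler_nat.
  case: (boolP (_ && _)) => // /andP[h1 h2]; rewrite lt0b.
  move: (hX (X k w)) (hY (Y k w)) h1 h2; rewrite /U /V !ler_norml.
  by move=> /andP[a1 _] /andP[a2 _] h1 h2; apply/andP; split; lra.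
have := hD (u - D) (v - D); have := hD (u + D) (v + D).
have := lipJ (u - D) (v - D) u v; have := lipJ (u + D) (v + D) u v.
have d1 (z : R) : z + D - z = D by ring.
have d2 (z : R) : z - D - z = - D by ring.
rewrite !d1 !d2 normrN (ger0_norm D0) !ler_norml.
move=> /andP[a1 a2] /andP[a3 a4] /andP[a5 a6] /andP[a7 a8].
by apply/andP; split; lra.
Qed.

End empirical_subcopula.

(** * Distribution functions and the probability integral transform *)

Section distribution_functions.
Context {R : realType} {d : measure_display} {Omega : measurableType d}.
Variable P : probability Omega R.
Implicit Types (A B : set Omega) (X Y : nat -> Omega -> R).

Lemma le_prob A B : measurable A -> measurable B -> A `<=` B ->
  fine (P A) <= fine (P B).
Proof.
move=> mA mB AB; rewrite fine_le ?fin_num_measure//.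
by apply: le_measure; rewrite ?inE.
Qed.

Lemma prob_setD A B : measurable A -> measurable B -> A `<=` B ->
  fine (P (B `\` A)) = fine (P B) - fine (P A).
Proof.
move=> mA mB AB; rewrite measureD//=; last first.
  by rewrite (le_lt_trans (probability_le1 P mB))// ltry.
by rewrite (setIidr AB) fineB// fin_num_measure.
Qed.

Lemma prob_setU A B : measurable A -> measurable B ->
  fine (P (A `|` B)) <= fine (P A) + fine (P B).
Proof.
move=> mA mB; rewrite -fineD ?fin_num_measure//.
rewrite fine_le ?fin_numD ?fin_num_measure//; first exact: measurableU.
exact: measureU2.
Qed.

Lemma prob_ge0_le1 A : measurable A -> 0 <= fine (P A) <= 1.
Proof.
by move=> mA; rewrite fine_ge0//= -lee_fin fineK ?fin_num_measure// probability_le1.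
Qed.

Lemma measurable_le_event (f : Omega -> R) a : measurable_fun setT f ->
  measurable [set w | (f w <= a)%R].
Proof.
move=> mf; rewrite -[X in measurable X]setTI.
exact: (measurable_fun_le (g := cst a)).
Qed.

Lemma measurable_le2_event (f g : Omega -> R) a b :
  measurable_fun setT f -> measurable_fun setT g ->
  measurable [set w | (f w <= a)%R /\ (g w <= b)%R].
Proof.
by move=> mf mg; apply: measurableI; exact: measurable_le_event.
Qed.

Lemma marg_df_nd X : measurable_fun setT (X 0%N) -> nondecreasing_fun (marg_df P X).
Proof.
move=> mX a b ab; apply: le_prob; try exact: measurable_le_event.
by move=> w /= /le_trans; exact.
Qed.

Lemma marg_df01 X x : measurable_fun setT (X 0%N) -> 0 <= marg_df P X x <= 1.
Proof. by move=> mX; apply: prob_ge0_le1; exact: measurable_le_event. Qed.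

Lemma marg_df_near1 X (e : R) : measurable_fun setT (X 0%N) -> 0 < e ->
  exists x, 1 - e <= marg_df P X x.
Proof.
move=> mX e0; pose X0 : {RV P >-> R} := mfun_Sub (mem_set mX).
have := @cvg_cdfy1 _ _ _ P X0; move/fine_cvgP => [_ /cvgrPdist_le /(_ _ e0)].
move=> [M [_ hM]]; have := hM (M + 1) ltac:(by rewrite /= ltrDl).
rewrite ler_norml => /andP[_ h]; exists (M + 1).
by move: h; rewrite /= lerBlDr addrC -lerBlDr.
Qed.

Lemma marg_df_near0 X (e : R) : measurable_fun setT (X 0%N) -> 0 < e ->
  exists x, marg_df P X x <= e.
Proof.
move=> mX e0; pose X0 : {RV P >-> R} := mfun_Sub (mem_set mX).
have := @cvg_cdfNy0 _ _ _ P X0; move/fine_cvgP => [_ /cvgrPdist_le /(_ _ e0)].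
move=> [M [_ hM]]; have := hM (M - 1) ltac:(by rewrite /= gtrBl).
rewrite ler_norml => /andP[h _]; exists (M - 1).
by move: h; rewrite /= sub0r lerN2.
Qed.

Lemma continuous_approx (F : R -> R) (H : R -> R -> R) :
  (forall e, 0 < e -> exists y, forall x, `|F x - H x y| <= e) ->
  (forall y, continuous (H^~ y)) -> continuous F.
Proof.
move=> FH cH x; apply/cvgrPdist_le => e e0.
have [y hy] := FH (e / 3) ltac:(by rewrite divr_gt0).
have /cvgrPdist_le/(_ (e / 3) ltac:(by rewrite divr_gt0)) := cH y x.
apply: filterS => z hz; have := hy x; have := hy z; move: hz.
rewrite !ler_norml => /andP[a1 a2] /andP[a3 a4] /andP[a5 a6].
by apply/andP; split; lra.
Qed.

(** The difference between [F x] and [H x y] is at most the probability of [Y > y], a bound free of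
    [x]; so [F] is a uniform limit of sections of [H]. *)
Lemma continuous_marg_df X Y : measurable_fun setT (X 0%N) -> measurable_fun setT (Y 0%N) ->
  (forall y, continuous (fun x => joint_df P X Y x y)) -> continuous (marg_df P X).
Proof.
move=> mX mY cH; apply: continuous_approx cH => e e0.
have [y hy] := marg_df_near1 Y e mY e0; exists y => x.
have mXx := measurable_le_event (X 0%N) x mX.
have mYy := measurable_le_event (Y 0%N) y mY.
have mXY := measurable_le2_event (X 0%N) (Y 0%N) x y mX mY.
have -> : marg_df P X x - joint_df P X Y x y =
    fine (P ([set w | X 0%N w <= x] `\` [set w | X 0%N w <= x /\ Y 0%N w <= y])).
  by rewrite prob_setD// => w [].
have mD := measurableD mXx mXY.
have /andP[p0 _] := prob_ge0_le1 _ mD; rewrite ger0_norm//.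
apply: (@le_trans _ _ (fine (P (~` [set w | Y 0%N w <= y])))).
  apply: le_prob => //; first exact: measurableC.
  by move=> w [/= Xx nXY] Yy; exact: nXY.
rewrite probability_setC// fineB ?fin_num_measure//=.
by move: hy; rewrite /marg_df; lra.
Qed.

Lemma joint_dfC X Y x y : joint_df P X Y x y = joint_df P Y X y x.
Proof. by congr (fine (P _)); apply/seteqP; split => w []. Qed.

Section integral_transform.
Variable X : nat -> Omega -> R.
Hypothesis mX : forall k, measurable_fun setT (X k).
Hypothesis cF : continuous (marg_df P X).
Let F := marg_df P X.
Let U := fun k w => F (X k w).

Lemma measurable_transform k : measurable_fun setT (U k).
Proof.
apply: measurableT_comp (mX k); apply: nondecreasing_measurable => // a b ab.
exact: marg_df_nd.
Qed.

Lemma marg_df_surj (u : R) : 0 < u < 1 -> exists x, F x = u.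
Proof.
move=> /andP[u0 u1]; have [a ha] := marg_df_near0 X u (mX 0%N) u0.
have [b hb] := marg_df_near1 X (1 - u) (mX 0%N) ltac:(by rewrite subr_gt0).
have {}hb : u <= F b by move: hb; rewrite subKr.
have [ab|/ltW ba] := leP a b.
  have [|c _ <-] := @IVT R F a b u ab (continuous_subspaceT cF); last by exists c.
  by rewrite ge_min le_max ha hb orbT.
exists a; apply/eqP; rewrite eq_le ha/=; apply: (le_trans hb).
exact: marg_df_nd.
Qed.

Lemma marg_df_transform (u : R) : 0 <= u <= 1 -> marg_df P U u = u.
Proof.
move=> /andP[u0 u1]; have mU := measurable_le_event (U 0%N) _ (measurable_transform 0).
have mXx x := measurable_le_event (X 0%N) x (mX 0%N).
have [->|u1'] := eqVneq u 1.
  rewrite /marg_df (_ : [set w | _] = setT) ?probability_setT//.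
  by apply/seteqP; split => // w _ /=; have /andP[] := marg_df01 X (X 0%N w) (mX 0%N).
have {u1 u1'} u1 : u < 1 by rewrite lt_neqAle u1'.
apply/eqP; rewrite eq_le; apply/andP; split.
  apply/ler_addgt0Pr => e e0.
  (* The inclusion of [U <= u] in [X <= x] needs [F x > u] strictly, since [F] may be flat at level
     [u]. The term [(u + 1) / 2] keeps the chosen level below 1, where it is attained. *)
  have [x hx] := marg_df_surj (Num.min (u + e) ((u + 1) / 2)) ltac:(
    rewrite lt_min gt_min; apply/andP; split; [apply/andP; split|apply/orP; right]; lra).
  apply: (@le_trans _ _ (F x)); last by rewrite hx ge_min lexx.
  apply: le_prob => // w /=; rewrite /U => h; rewrite leNgt; apply/negP => xX.
  have : F x <= u by apply: le_trans h; apply: marg_df_nd; [exact: mX|exact: ltW].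
  by rewrite hx ge_min => /orP[]; lra.
have [->|u0'] := eqVneq u 0; first by have /andP[] := prob_ge0_le1 _ (mU 0).
have [x hx] := marg_df_surj u ltac:(by rewrite lt_neqAle eq_sym u0' u0 u1).
rewrite -[leLHS]hx; apply: le_prob => // w /=; rewrite /U -hx => h.
by apply: marg_df_nd => //; exact: mX.
Qed.

Lemma marg_df_transform_lip (u u' : R) : u <= u' ->
  marg_df P U u' - marg_df P U u <= u' - u.
Proof.
move=> uu; have U01 w : 0 <= U 0%N w <= 1 by exact: marg_df01.
have lt0 (z : R) : z < 0 -> marg_df P U z = 0.
  move=> z0; rewrite /marg_df (_ : [set w | _] = set0) ?measure0//.
  by apply/seteqP; split => // w /= h; have /andP[] := U01 w; lra.
have gt1 (z : R) : 1 < z -> marg_df P U z = 1.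
  move=> z1; rewrite /marg_df (_ : [set w | _] = setT) ?probability_setT//.
  by apply/seteqP; split => // w _ /=; have /andP[] := U01 w; lra.
have mE (z : R) : [\/ z < 0 /\ marg_df P U z = 0, 0 <= z <= 1 /\ marg_df P U z = z
    | 1 < z /\ marg_df P U z = 1].
  have [z0|z0] := ltP z 0; first by apply: Or31; rewrite lt0.
  have [z1|z1] := ltP 1 z; first by apply: Or33; rewrite gt1.
  by apply: Or32; split => //; apply: marg_df_transform; rewrite z0.
by case: (mE u) => -[h ->]; case: (mE u') => -[h' ->]; lra.
Qed.

End integral_transform.

(** Intersecting the strip [u < U <= u'] with [V <= v] only decreases its probability, so a
    Lipschitz marginal suffices. *)
Lemma joint_df_lip U V : measurable_fun setT (U 0%N) -> measurable_fun setT (V 0%N) ->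
  (forall u u', u <= u' -> marg_df P U u' - marg_df P U u <= u' - u) ->
  forall u u' v, `|joint_df P U V u v - joint_df P U V u' v| <= `|u - u'|.
Proof.
move=> mU mV lipU u u' v; wlog uu : u u' / u <= u'.
  move=> h; case: (leP u u') => [/h//|/ltW/h].
  by rewrite distrC => /le_trans; apply; rewrite distrC.
have mUu a := measurable_le_event (U 0%N) a mU.
have mUV a := measurable_le2_event (U 0%N) (V 0%N) a v mU mV.
rewrite distrC [leRHS]distrC (ger0_norm (_ : 0 <= u' - u)) ?subr_ge0//.
rewrite /joint_df -prob_setD//; last by move=> w /= [/le_trans h ->]; rewrite h.
have /andP[p0 _] := prob_ge0_le1 _ (measurableD (mUV u') (mUV u)); rewrite ger0_norm//.
apply: le_trans (lipU _ _ uu); rewrite /marg_df -prob_setD//; last first.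
  by move=> w /= /le_trans; exact.
apply: le_prob; [exact: measurableD|exact: measurableD|].
by move=> w [/= [h1 h2] h3]; split => // h4; exact: h3.
Qed.

End distribution_functions.

(** * Copulas of doubly stochastic measures and their Markov kernels *)

Section copula.
Context {R : realType}.
Variable mu : probability (R * R)%type R.
Hypothesis ds_mu : doubly_stochastic mu.

Let measurable_rect (a b c e : R) :
  measurable (`[a, b]%classic `*` `[c, e]%classic : set (R * R)).
Proof. exact: measurableX. Qed.

Lemma copula_1r (u : R) : 0 <= u <= 1 -> copula_of mu u 1 = u.
Proof.
move=> /andP[u0 u1]; rewrite /copula_of (ds_mu.2 `[0, u]%classic _ _).1//.
  by rewrite lebesgue_measure_itv/= lte_fin; case: ltP => /= u0'; lra.
by move=> z /=; rewrite !in_itv/= => /andP[-> /le_trans]; exact.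
Qed.

Lemma copula_1l (v : R) : 0 <= v <= 1 -> copula_of mu 1 v = v.
Proof.
move=> /andP[v0 v1]; rewrite /copula_of (ds_mu.2 `[0, v]%classic _ _).2//.
  by rewrite lebesgue_measure_itv/= lte_fin; case: ltP => /= v0'; lra.
by move=> z /=; rewrite !in_itv/= => /andP[-> /le_trans]; exact.
Qed.

Lemma copula_0r (u : R) : 0 <= u <= 1 -> copula_of mu u 0 = 0.
Proof.
move=> u01; apply/eqP; rewrite eq_le.
have /andP[-> _] := prob_ge0_le1 mu _ (measurable_rect 0 u 0 0); rewrite andbT.
rewrite -[leRHS](copula_1l 0) ?lexx ?ler01//; apply: le_prob => //.
move=> [a b] /= []; rewrite !in_itv/= => /andP[a0 au] ->; split => //.
by rewrite a0 (le_trans au)//; case/andP: u01.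
Qed.

Lemma copula_0l (v : R) : 0 <= v <= 1 -> copula_of mu 0 v = 0.
Proof.
move=> v01; apply/eqP; rewrite eq_le.
have /andP[-> _] := prob_ge0_le1 mu _ (measurable_rect 0 0 0 v); rewrite andbT.
rewrite -[leRHS](copula_1r 0) ?lexx ?ler01//; apply: le_prob => //.
move=> [a b] /= []; rewrite !in_itv/= => -> /andP[b0 bv]; split => //.
by rewrite b0 (le_trans bv)//; case/andP: v01.
Qed.

Variable K : R.-pker R ~> R.
Hypothesis K_mu : markov_kernel_of mu K.

Lemma copula_increment (a b c : R) : 0 <= a -> a <= b -> b <= 1 -> c <= 1 ->
  copula_of mu b c - copula_of mu a c =
  fine (\int[lebesgue_measure]_(t in `]a, b]%classic) K t `[0%R, c]%classic)%E.
Proof.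
move=> a0 ab b1 c1; rewrite K_mu.2//; last 2 first.
- move=> z /=; rewrite !in_itv/= => /andP[az zb].
  by rewrite (le_trans a0 (ltW az)) (le_trans zb).
- by move=> z /=; rewrite !in_itv/= => /andP[-> /le_trans]; exact.
rewrite /copula_of -prob_setD//; last first.
  move=> [z1 z2] /= []; rewrite !in_itv/= => /andP[-> z1a] ->; split => //.
  exact: le_trans z1a ab.
congr (fine (mu _)); apply/seteqP; split => -[z1 z2] /=; rewrite !in_itv/=.
  move=> [[/andP[z10 z1b] z2c] nz]; split => //; rewrite z1b andbT ltNge.
  by apply/negP => z1a; apply: nz; rewrite z10 z1a.
move=> [/andP[az zb] z2c]; split; first by rewrite zb (le_trans a0 (ltW az)).
by case=> /andP[_]; rewrite leNgt az.
Qed.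

(** The increment is the integral of the kernel over []a, b]], so a pointwise bound on the kernel
    passes to its average. *)
Lemma copula_increment_close (a b c kappa h : R) :
  0 <= a -> a < b -> b <= 1 -> c <= 1 ->
  (forall t, a < t -> t <= b -> `|fine (K t `[0%R, c]%classic) - kappa| <= h) ->
  `|(copula_of mu b c - copula_of mu a c) - kappa * (b - a)| <= h * (b - a).
Proof.
move=> a0 ab b1 c1 hK; rewrite copula_increment ?(ltW ab)//.
have Kfin t : K t `[0%R, c]%classic \is a fin_num.
  rewrite ge0_fin_numE//; apply: le_lt_trans (ltry 1).
  rewrite -(@prob_kernel _ _ _ _ _ K t).
  by apply: le_measure; rewrite ?inE.
have mK : measurable_fun `]a, b]%classic (fun t => K t `[0%R, c]%classic).
  by apply: measurable_funTS; exact: measurable_kernel.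
have ba : 0 < b - a by rewrite subr_gt0.
have cstI (r : R) : (\int[@lebesgue_measure R]_(t in `]a, b]%classic) r%:E)%E =
    (r * (b - a))%:E.
  have leb_ab : lebesgue_measure `]a, b]%classic = (b - a)%:E.
    by rewrite lebesgue_measure_itv/= lte_fin ab -EFinD.
  by rewrite integral_cst// EFinM; congr (_ * _)%E; exact: leb_ab.
have up t : a < t -> t <= b -> 0 <= fine (K t `[0%R, c]%classic) <= kappa + h.
  move=> ta tb; rewrite fine_ge0//=.
  by have := hK t ta tb; rewrite ler_norml => /andP[_]; lra.
have hi : (\int[lebesgue_measure]_(t in `]a, b]%classic) K t `[0%R, c]%classic
    <= ((kappa + h) * (b - a))%:E)%E.
  rewrite -cstI; apply: ge0_le_integral => //.
  move=> t; rewrite /= in_itv/= => /andP[ta tb].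
  by rewrite -(fineK (Kfin t)) lee_fin; have /andP[] := up t ta tb.
(* The comparison of integrals is the one for nonnegative functions, so the lower constant is first
   raised to 0 if negative. *)
have lo : (((Num.max 0 (kappa - h)) * (b - a))%:E <=
    \int[lebesgue_measure]_(t in `]a, b]%classic) K t `[0%R, c]%classic)%E.
  rewrite -cstI; apply: ge0_le_integral => //.
  - by move=> t _; rewrite lee_fin le_max lexx.
  - move=> t; rewrite /= in_itv/= => /andP[ta tb].
    rewrite -(fineK (Kfin t)) lee_fin ge_max; have /andP[-> _] := up t ta tb.
    by have := hK t ta tb; rewrite ler_norml => /andP[+ _]; lra.
have Ifin : (\int[lebesgue_measure]_(t in `]a, b]%classic) K t `[0%R, c]%classic)%E
    \is a fin_num.
  rewrite ge0_fin_numE; first exact: le_lt_trans hi (ltry _).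
  exact: integral_ge0.
move: hi lo; rewrite -(fineK Ifin) !lee_fin.
set I := fine _ => hi lo; have : (kappa - h) * (b - a) <= I.
  by apply: le_trans lo; rewrite ler_pM2r// le_max lexx orbT.
by move=> {}lo; rewrite ler_norml /=; apply/andP; split; lra.
Qed.

End copula.

(** * The transformed sample has the copula as its distribution function *)

Section empirical_transform.
Context {R : realType} {d : measure_display} {Omega : measurableType d}.
Variable P : probability Omega R.
Variables X Y : nat -> Omega -> R.

Lemma iid_pairs_comp (f g : R -> R) :
  measurable_fun setT f -> measurable_fun setT g -> iid_pairs P X Y ->
  iid_pairs P (fun k w => f (X k w)) (fun k w => g (Y k w)).
Proof.
move=> mf mg [indXY idXY].
have mfg (B : set (R * R)) : measurable B ->
    measurable ((fun z : R * R => (f z.1, g z.2)) @^-1` B).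
  move=> mB; rewrite -[X in measurable X]setTI.
  have mfg : measurable_fun setT (fun z : R * R => (f z.1, g z.2)).
    by apply: measurable_fun_pair; exact: measurableT_comp.
  exact: mfg.
split=> [I B uI mB|k B mB].
  exact: (indXY I (fun k => (fun z : R * R => (f z.1, g z.2)) @^-1` B k) uI
    (fun k => mfg _ (mB k))).
exact: (idXY k ((fun z : R * R => (f z.1, g z.2)) @^-1` B) (mfg _ mB)).
Qed.

Hypothesis mX : forall k, measurable_fun setT (X k).
Hypothesis mY : forall k, measurable_fun setT (Y k).
Hypothesis cF : continuous (marg_df P X).
Hypothesis cG : continuous (marg_df P Y).
Variable mu : probability (R * R)%type R.
Hypothesis ds_mu : doubly_stochastic mu.
Hypothesis sklar : forall x y : R,
  joint_df P X Y x y = copula_of mu (marg_df P X x) (marg_df P Y y).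

Let U := fun k w => marg_df P X (X k w).
Let V := fun k w => marg_df P Y (Y k w).

Lemma joint_df_transform_1r (u : R) : 0 <= u <= 1 -> joint_df P U V u 1 = u.
Proof.
move=> u01; rewrite -[RHS](marg_df_transform P X mX cF u u01).
congr (fine (P _)); apply/seteqP; split => w /=; [by case|move=> h; split => //].
by have /andP[] := marg_df01 P Y (Y 0%N w) (mY 0%N).
Qed.

Lemma joint_df_transform_1l (v : R) : 0 <= v <= 1 -> joint_df P U V 1 v = v.
Proof.
move=> v01; rewrite -[RHS](marg_df_transform P Y mY cG v v01).
congr (fine (P _)); apply/seteqP; split => w /=; [by case|move=> h; split => //].
by have /andP[] := marg_df01 P X (X 0%N w) (mX 0%N).
Qed.

Lemma joint_df_transform (u v : R) : 0 <= u <= 1 -> 0 <= v <= 1 ->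
  joint_df P U V u v = copula_of mu u v.
Proof.
move=> u01 v01; have /andP[u0 u1] := u01; have /andP[v0 v1] := v01.
have mU := measurable_transform P X mX 0; have mV := measurable_transform P Y mY 0.
have mUa a := measurable_le_event (U 0%N) a mU.
have mVa a := measurable_le_event (V 0%N) a mV.
have mUV a b := measurable_le2_event (U 0%N) (V 0%N) a b mU mV.
have PU := marg_df_transform P X mX cF; have PV := marg_df_transform P Y mY cG.
have J0 : 0 <= joint_df P U V u v by have /andP[] := prob_ge0_le1 P _ (mUV u v).
(* The marginals need not attain 0 or 1, so [sklar] cannot be invoked at these values; there both
   sides are fixed by the uniform margins. *)
have [->|u1'] := eqVneq u 1; first by rewrite joint_df_transform_1l// copula_1l.
have [->|v1'] := eqVneq v 1; first by rewrite joint_df_transform_1r// copula_1r.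
have [uz|u0'] := eqVneq u 0.
  rewrite uz in J0 *; rewrite copula_0l//; apply/eqP; rewrite eq_le J0 andbT.
  rewrite -[leRHS](PU 0) ?lexx ?ler01//; apply: le_prob => //.
  by move=> w [].
have [vz|v0'] := eqVneq v 0.
  rewrite vz in J0 *; rewrite copula_0r//; apply/eqP; rewrite eq_le J0 andbT.
  rewrite -[leRHS](PV 0) ?lexx ?ler01//; apply: le_prob => //.
  by move=> w [].
have [x hx] := marg_df_surj P X mX cF u ltac:(by rewrite !lt_neqAle eq_sym u0' u0 u1').
have [y hy] := marg_df_surj P Y mY cG v ltac:(by rewrite !lt_neqAle eq_sym v0' v0 v1').
rewrite -[in RHS]hx -[in RHS]hy -sklar.
have mXx := measurable_le_event (X 0%N) x (mX 0%N).
have mYy := measurable_le_event (Y 0%N) y (mY 0%N).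
have mXY := measurable_le2_event (X 0%N) (Y 0%N) x y (mX 0%N) (mY 0%N).
have Xx w : X 0%N w <= x -> U 0%N w <= u.
  by move=> h; rewrite -hx; apply: marg_df_nd.
have Yy w : Y 0%N w <= y -> V 0%N w <= v.
  by move=> h; rewrite -hy; apply: marg_df_nd.
have XY_UV : [set w | X 0%N w <= x /\ Y 0%N w <= y] `<=`
    [set w | U 0%N w <= u /\ V 0%N w <= v].
  by move=> w [/= /Xx h1 /Yy h2].
(* The two events differ by parts of [U <= u, X > x] and [V <= v, Y > y],
   which are null since [P(U <= u) = u = P(X <= x)]. *)
apply/eqP; rewrite -subr_eq0 eq_le /joint_df -prob_setD//.
have /andP[-> _] := prob_ge0_le1 P _ (measurableD (mUV u v) mXY); rewrite andbT.
pose A := [set w | U 0%N w <= u] `\` [set w | X 0%N w <= x].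
pose B := [set w | V 0%N w <= v] `\` [set w | Y 0%N w <= y].
have mA : measurable A by exact: measurableD.
have mB : measurable B by exact: measurableD.
apply: (@le_trans _ _ (fine (P (A `|` B)))).
  apply: le_prob; [exact: measurableD|exact: measurableU|].
  move=> w [/= [h1 h2] h3]; rewrite /A /B /=.
  by have [h|h] := pselect (X 0%N w <= x); [right; split => // h'; exact: h3|left].
apply: le_trans (prob_setU P _ _ mA mB) _.
rewrite /A /B !prob_setD//.
have := PU u u01; have := PV v v01; have := hx; have := hy.
by rewrite /marg_df => -> -> -> ->; rewrite !subrr addr0.
Qed.

End empirical_transform.

(** * Rates, continuity of the kernel and strong consistency *)

Lemma near_powRN_le {R : realType} (a e : R) : 0 < a -> 0 < e ->
  \forall n \near \oo, n%:R `^ (- a) <= e.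
Proof.
move=> a0 e0; have [M0 _ hM] : \forall n \near \oo, Num.max 1 ((e^-1) `^ (a^-1)) <= n%:R.
  exact: nbhs_infty_ger.
exists M0 => // n /hM; rewrite ge_max => /andP[n1 ne].
have n0 : 0 < n%:R :> R by exact: lt_le_trans n1.
rewrite powRN -[leRHS]invrK lef_pV2 ?posrE ?powR_gt0 ?invr_gt0//.
have -> : e^-1 = (e^-1 `^ a^-1) `^ a.
  by rewrite -powRrM mulVf ?gt_eqF// powRr1// invr_ge0 ltW.
by rewrite ge0_ler_powR// ?nnegrE ?powR_ge0// ltW.
Qed.

(** The upper bound limits the amplification of errors, the bound on the inverse makes the mesh
    shrink. The factor 2 comes from [n^s < N + 1 <= 2 N]. *)
Lemma Nn_bounds {R : realType} (s : R) (n : nat) : 0 < s -> (0 < n)%N ->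
  [/\ (0 < Nn s n)%N, (Nn s n)%:R <= n%:R `^ s & (Nn s n)%:R^-1 <= 2 * n%:R `^ (- s)].
Proof.
move=> s0 n0; have n1 : 1 <= n%:R :> R by rewrite ler1n.
have z1 : 1 <= n%:R `^ s by rewrite -[leLHS](powRr0 n%:R) ler_powR// ltW.
have z0 : 0 < n%:R `^ s by exact: lt_le_trans z1.
have /andP[f1 f2] := floor_itv (n%:R `^ s).
have fge1 : 1 <= Num.floor (n%:R `^ s) by rewrite floor_ge_int.
have NE : (Nn s n)%:R = (Num.floor (n%:R `^ s))%:~R :> R.
  by rewrite /Nn pmulrn gez0_abs// (le_trans _ fge1).
have N1 : 1 <= (Nn s n)%:R :> R by rewrite NE -[leLHS]/(1%:~R) ler_int.
split; first by rewrite -(ler_nat R).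
  by rewrite NE.
rewrite powRN -[leRHS]invrK lef_pV2 ?posrE; last 2 first.
- exact: lt_le_trans N1.
- by rewrite invr_gt0 mulr_gt0// invr_gt0.
rewrite invfM invrK ler_pdivrMl//.
by move: f2; rewrite intrD -NE; lra.
Qed.

Lemma continuous_kernel_near {R : realType} (K : R.-pker R ~> R) (u0 v0 e : R) :
  continuous_kernel K -> 0 <= u0 <= 1 -> 0 <= v0 <= 1 -> 0 < e ->
  exists2 r : R, 0 < r & forall u v : R, 0 <= u <= 1 -> 0 <= v <= 1 ->
    `|u - u0| < r -> `|v - v0| < r ->
    `|fine (K u `[0, v]%classic) - fine (K u0 `[0, v0]%classic)| <= e.
Proof.
move=> /subspace_continuousP cK u001 v001 e0.
have p01 : unit_sq (u0, v0) by split; rewrite /= in_itv.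
have /cvgrPdist_le /(_ e e0) := cK _ p01.
rewrite near_withinE => /nbhs_ballP[r /= r0 hr]; exists r => // u v u01 v01 hu hv.
rewrite distrC; apply: (hr (u, v)); last by split; rewrite /= in_itv.
by split; rewrite /= /ball/= distrC.
Qed.

Lemma emp_df01 {R : realType} {d : measure_display} {Omega : measurableType d}
  (X : nat -> Omega -> R) (n : nat) (w : Omega) (x : R) : (0 < n)%N ->
  0 <= emp_df X n w x <= 1.
Proof.
move=> n0; have n0' : 0 < n%:R :> R by rewrite ltr0n.
rewrite divr_ge0 ?sumr_ge0//= ler_pdivrMr// mul1r.
rewrite -[leRHS](_ : \sum_(k < n) 1 = n%:R); last by rewrite sumr_const card_ord.
by apply: ler_sum => k _; rewrite lern1 leq_b1.
Qed.

Section consistency.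
Context {R : realType} {d : measure_display} {Omega : measurableType d}.
Variable P : probability Omega R.
Variables X Y : nat -> Omega -> R.
Hypothesis mX : forall k, measurable_fun setT (X k).
Hypothesis mY : forall k, measurable_fun setT (Y k).
Hypothesis iidXY : iid_pairs P X Y.
Hypothesis cH : continuous (fun p : R * R => joint_df P X Y p.1 p.2).
Variable mu : probability (R * R)%type R.
Hypothesis ds_mu : doubly_stochastic mu.
Hypothesis sklar : forall x y : R,
  joint_df P X Y x y = copula_of mu (marg_df P X x) (marg_df P Y y).
Variable K : R.-pker R ~> R.
Hypothesis K_mu : markov_kernel_of mu K.
Hypothesis cK : continuous_kernel K.

Let F := marg_df P X.
Let G := marg_df P Y.
Let U := fun k w => F (X k w).
Let V := fun k w => G (Y k w).

Let cF : continuous F.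
Proof.
apply: (@continuous_marg_df _ _ _ P X Y) => // y x.
exact: (cvg_comp2 (@cvg_id _ (nbhs x)) (cvg_cst y) (cH (x, y))).
Qed.

Let cG : continuous G.
Proof.
apply: (@continuous_marg_df _ _ _ P Y X) => // x y.
under eq_fun do rewrite joint_dfC.
exact: (cvg_comp2 (cvg_cst x) (@cvg_id _ (nbhs y)) (cH (x, y))).
Qed.

Let mU k : measurable_fun setT (U k). Proof. exact: measurable_transform. Qed.
Let mV k : measurable_fun setT (V k). Proof. exact: measurable_transform. Qed.
Let U01 k w : 0 <= U k w <= 1. Proof. exact: marg_df01. Qed.
Let V01 k w : 0 <= V k w <= 1. Proof. exact: marg_df01. Qed.

Let lipUV u v u' v' : `|joint_df P U V u v - joint_df P U V u' v'|
  <= `|u - u'| + `|v - v'|.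
Proof.
have -> : joint_df P U V u v - joint_df P U V u' v' =
  (joint_df P U V u v - joint_df P U V u' v)
  + (joint_df P U V u' v - joint_df P U V u' v') by ring.
apply: le_trans (ler_normD _ _) _; apply: lerD.
  by apply: joint_df_lip => //; exact: (marg_df_transform_lip P X mX cF).
rewrite !(joint_dfC P U V).
by apply: joint_df_lip => //; exact: (marg_df_transform_lip P Y mY cG).
Qed.

Lemma ae_transform_lln (b : R) : 0 < b < 1 / 2 ->
  {ae P, forall w, \forall n \near \oo, forall u v : R,
    `|emp_joint U V n w u v - joint_df P U V u v| <= n%:R `^ (- b) + 2 / n%:R}.
Proof.
move=> b01; apply: ae_uniform_lln => //; apply: iid_pairs_comp => //;
  by apply: nondecreasing_measurable => // x y xy; exact: marg_df_nd.
Qed.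

Lemma emp_marg_df_close (n : nat) (w : Omega) (D : R) :
  (forall u v : R, `|emp_joint U V n w u v - joint_df P U V u v| <= D) ->
  (forall x, `|emp_df X n w x - F x| <= D) /\ (forall y, `|emp_df Y n w y - G y| <= D).
Proof.
move=> hD; split.
  (* Since [V k <= 1], fixing the second argument at 1 turns the joint empirical distribution
     function into that of the [U k]. *)
  apply: (emp_df_transform X F (fun u => joint_df P U V u 1)).
  - by move=> a b ab; exact: marg_df_nd.
  - move=> u; rewrite (_ : emp_df _ n w u = emp_joint U V n w u 1)//.
    congr (_ / _); apply: eq_bigr => k _.
    by have /andP[_ ->] := V01 k w; rewrite andbT.
  - by move=> u u'; apply: le_trans (lipUV _ _ _ _) _; rewrite subrr normr0 addr0.
  - by move=> x; apply: joint_df_transform_1r => //; exact: marg_df01.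
apply: (emp_df_transform Y G (fun v => joint_df P U V 1 v)).
- by move=> a b ab; exact: marg_df_nd.
- move=> v; rewrite (_ : emp_df _ n w v = emp_joint U V n w 1 v)//.
  congr (_ / _); apply: eq_bigr => k _.
  by have /andP[_ ->] := U01 k w.
- by move=> v v'; apply: le_trans (lipUV _ _ _ _) _; rewrite subrr normr0 add0r.
- by move=> y; apply: joint_df_transform_1l => //; exact: marg_df01.
Qed.

Lemma copula_slope_close (N l : nat) (c kappa h : R) : (l < N)%N -> c <= 1 ->
  (forall t : R, l%:R / N%:R < t -> t <= l.+1%:R / N%:R ->
     `|fine (K t `[0%R, c]%classic) - kappa| <= h) ->
  `|N%:R * (copula_of mu (l.+1%:R / N%:R) c - copula_of mu (l%:R / N%:R) c)
    - kappa| <= h.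
Proof.
move=> lN c1 hK; have N0 : (0 < N)%N by exact: leq_ltn_trans lN.
have N0' : 0 < N%:R :> R by rewrite ltr0n.
have dN : l.+1%:R / N%:R - l%:R / N%:R = N%:R^-1 :> R.
  by rewrite -mulrBl -natr1 addrAC subrr add0r mul1r.
have := @copula_increment_close _ mu K K_mu (l%:R / N%:R) (l.+1%:R / N%:R) c kappa h.
rewrite dN => /(_ _ _ _ c1 hK) H.
have {}H : `|copula_of mu (l.+1%:R / N%:R) c - copula_of mu (l%:R / N%:R) c
    - kappa / N%:R| <= h / N%:R.
  apply: H; first by rewrite divr_ge0.
    by rewrite -subr_gt0 dN invr_gt0.
  by rewrite ler_pdivrMr// mul1r ler_nat.
rewrite -(ler_pM2l N0') -[X in X * `|_|](gtr0_norm N0') -normrM in H.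
move: H; rewrite mulrBr [N%:R * (kappa / _)]mulrCA [N%:R * (h / _)]mulrCA.
by rewrite divff ?gt_eqF// !mulr1.
Qed.

(** The kernel is evaluated in the column of [F_n x] and on grid lines near [G_n y]. These are
    within [1/N] of the empirical values, which are within [D] of [F x] and [G y]; hence the
    condition [D + 1/N < r]. *)
Lemma est_df_close (s : R) (n : nat) (w : Omega) (x y D r h : R) :
  (0 < n)%N -> (0 < Nn s n)%N ->
  (forall u v : R, `|emp_joint U V n w u v - joint_df P U V u v| <= D) ->
  (forall u v : R, 0 <= u <= 1 -> 0 <= v <= 1 -> `|u - F x| < r -> `|v - G y| < r ->
    `|fine (K u `[0%R, v]%classic) - fine (K (F x) `[0%R, G y]%classic)| <= h) ->
  D + (Nn s n)%:R^-1 < r ->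
  `|est_df X Y s n w x y - fine (K (F x) `[0%R, G y]%classic)|
    <= 4 * ((Nn s n)%:R * (3 * D + 2 / n%:R)) + h.
Proof.
rewrite /est_df; move: (Nn s n) => N n0 N0 hD hr Dr.
have N0' : 0 < N%:R :> R by rewrite ltr0n.
have [hX hY] := emp_marg_df_close n w D hD.
have grid (m : nat) : (m <= N)%N -> 0 <= (m%:R / N%:R : R) <= 1.
  by move=> mN; rewrite divr_ge0//= ler_pdivrMr// mul1r ler_nat.
apply: (cb_kernel_close (copula_of mu)) => //; [exact: emp_df01|exact: emp_df01|..].
- move=> u v u01 v01; rewrite -(joint_df_transform P X Y mX mY cF cG mu ds_mu sklar)//.
  have /andP[_ u1] := u01; have /andP[_ v1] := v01.
  apply: bilin_interp_close => // u' v'.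
  exact: (emp_subcop_close X Y F G).
- by move=> u u01; exact: copula_0r.
- move=> l m lN mN /andP[lx xl] my; apply: copula_slope_close => //.
    by have /andP[] := grid _ mN.
  have hl : l.+1%:R / N%:R = l%:R / N%:R + N%:R^-1 :> R by rewrite -natr1 mulrDl mul1r.
  have /andP[l0 _] := grid _ (ltnW lN); have /andP[_ l1] := grid _ lN.
  have m01 := grid _ mN; have := hX x; have := hY y.
  move: l0 l1 m01 my lx xl Dr; rewrite hl.
  (* Quotients and empirical values become variables, which leaves linear goals. *)
  move: (N%:R^-1) (l%:R / N%:R) (m%:R / N%:R) (emp_df X n w x) (emp_df Y n w y).
  move=> i a c p q l0 l1 m01 cq ap pai Dr hq hp t lt tl.
  apply: hr => //.
  + by apply/andP; split; lra.
  + move: hp; rewrite ler_norml ltr_norml => /andP[? ?].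
    by apply/andP; split; lra.
  + move: hq cq; rewrite !ler_norml ltr_norml => /andP[? ?] /andP[? ?].
    by apply/andP; split; lra.
Qed.

(** As [b < 1], [1/n <= n^-b]. So [D + 1/N <= 3 n^-b + 2 n^-s <= 5 r / 12], and
    [3 D + 2/n <= 11 n^-b]; the total [4 * 11 * n^(s - b)] is at most [e / 2] when
    [n^(s - b) <= e / 88]. *)
Lemma est_df_close_powR (s b : R) (n : nat) (w : Omega) (x y r e : R) :
  (0 < n)%N -> 0 < s -> b < 1 -> 0 < r ->
  (forall u v : R,
    `|emp_joint U V n w u v - joint_df P U V u v| <= n%:R `^ (- b) + 2 / n%:R) ->
  (forall u v : R, 0 <= u <= 1 -> 0 <= v <= 1 -> `|u - F x| < r -> `|v - G y| < r ->
    `|fine (K u `[0%R, v]%classic) - fine (K (F x) `[0%R, G y]%classic)| <= e / 2) ->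
  n%:R `^ (- s) <= r / 12 -> n%:R `^ (- b) <= r / 12 ->
  n%:R `^ (- (b - s)) <= e / 88 ->
  `|est_df X Y s n w x y - fine (K (F x) `[0%R, G y]%classic)| <= e.
Proof.
move=> n0 s0 b1 r0 hD hr hs hb hbs.
have [N0 Ns Ninv] := Nn_bounds s n s0 n0.
have nb : n%:R^-1 <= n%:R `^ (- b).
  by rewrite -powR_inv1 ?ler_powR ?ler1n// lerN2 ltW.
have ns_nb : n%:R `^ s * n%:R `^ (- b) = n%:R `^ (- (b - s)).
  by rewrite opprB powRD// pnatr_eq0 -lt0n n0 implybT.
have b_ge0 : 0 <= n%:R `^ (- b) by exact: powR_ge0.
have i_ge0 : 0 <= n%:R^-1 :> R by rewrite invr_ge0.
apply: le_trans (est_df_close s n w x y _ r _ n0 N0 hD hr _) _; first by lra.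
have : (Nn s n)%:R * (3 * (n%:R `^ (- b) + 2 / n%:R) + 2 / n%:R)
    <= 11 * (n%:R `^ s * n%:R `^ (- b)).
  by rewrite mulrCA; apply: ler_pM => //; lra.
by rewrite ns_nb; lra.
Qed.

Lemma est_df_cvg (s b : R) (w : Omega) (x y : R) : 0 < s -> s < b -> b < 1 ->
  (\forall n \near \oo, forall u v : R,
    `|emp_joint U V n w u v - joint_df P U V u v| <= n%:R `^ (- b) + 2 / n%:R) ->
  est_df X Y s n w x y @[n --> \oo] --> fine (K (F x) `[0%R, G y]%classic).
Proof.
move=> s0 sb b1 lln; apply/cvgrPdist_le => e e0.
have e2 : 0 < e / 2 by rewrite divr_gt0.
have [r r0 hr] := continuous_kernel_near K _ _ _ cK
  (marg_df01 P X x (mX 0)) (marg_df01 P Y y (mY 0)) e2.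
have r12 : 0 < r / 12 by rewrite divr_gt0.
near=> n; rewrite distrC; apply: (est_df_close_powR s b n w x y r e) => //.
- by near: n; exact: nbhs_infty_gt.
- by near: n; exact: lln.
- by near: n; exact: near_powRN_le.
- by near: n; apply: near_powRN_le => //; exact: lt_trans sb.
- by near: n; apply: near_powRN_le; [rewrite subr_gt0|rewrite divr_gt0].
Unshelve. all: by end_near.
Qed.

End consistency.

Theorem theorem5p3 (R : realType) (d : measure_display)
  (Omega : measurableType d) (P : probability Omega R)
  (X Y : nat -> Omega -> R)
  (mX : forall k, measurable_fun setT (X k))
  (mY : forall k, measurable_fun setT (Y k))
  (hiid : iid_pairs P X Y)
  (hcont : continuous (fun p : R * R => joint_df P X Y p.1 p.2))
  (muA : probability (R * R)%type R) (hmuA : doubly_stochastic muA)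
  (hsklar : forall x y : R,
      joint_df P X Y x y = copula_of muA (marg_df P X x) (marg_df P Y y))
  (KA : R.-pker R ~> R) (hKA : markov_kernel_of muA KA)
  (hKAc : continuous_kernel KA)
  (s : R) (hs0 : 0 < s) (hs1 : s < 1 / 2)
  (x : R)
  (hreg : {ae P, forall w, regular_at X Y s x w})
  (KH : probability R R)
  (hKH : forall y : R,
      KH `]-oo, y]%classic = KA (marg_df P X x) `[0, marg_df P Y y]%classic) :
  {ae P, forall w,
      (fun n : nat => r_est X Y s n w x) @ \oo --> (\int[KH]_y (y%:E))%E}.
Proof.
(* The midpoint satisfies both [b < 1/2], for concentration, and [s < b], for the amplified
   error. *)
pose b := (s + 1 / 2) / 2.
have b01 : 0 < b < 1 / 2 by rewrite /b; apply/andP; split; lra.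
have lln := ae_transform_lln P X Y mX mY hiid hcont b b01.
apply: filterS2 lln hreg => w lln [nu [nuE ui]].
(* The laws [nu n] are tied to the estimator only for [n > 0], hence the shift. The path [w] is
   fixed before [y], so one null set serves all [y]. *)
have cdf_cvg y : nu n.+1 `]-oo, y]%classic @[n --> \oo] --> KH `]-oo, y]%classic.
  have sb : s < b by rewrite /b; lra.
  have b1 : b < 1 by rewrite /b; lra.
  have c := est_df_cvg P X Y mX mY hcont muA hmuA hsklar KA hKA hKAc s b w x y
    hs0 sb b1 lln.
  have c1 : [sequence est_df X Y s n.+1 w x y]_n @ \oo -->
      fine (KA (marg_df P X x) `[0, marg_df P Y y]%classic).
    by rewrite (cvg_shiftS (fun n => est_df X Y s n w x y)).
  have KHfin : KH `]-oo, y]%classic \is a fin_num by exact: fin_num_measure.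
  rewrite -(fineK KHfin) hKH.
  rewrite (_ : (fun n => _) = EFin \o [sequence est_df X Y s n.+1 w x y]_n); last first.
    by apply/funext => n; rewrite nuE.
  by apply: cvg_EFin => //; exact: nearW.
rewrite -(cvg_shiftS (fun n => r_est X Y s n w x)).
have r_estE n : r_est X Y s n.+1 w x =
    (\int[lebesgue_measure]_(y in `]0%R, +oo[%classic) (1 - nu n.+1 `]-oo, y]%classic)
    - \int[lebesgue_measure]_(y in `]-oo, 0%R[%classic) nu n.+1 `]-oo, y]%classic)%E.
  rewrite /r_est /r_plus /r_minus; congr (_ - _)%E; apply: eq_integral => y _.
    rewrite (nuE n.+1 (ltn0Sn n) y).
    by move: (est_df X Y s n.+1 w x y) => z; rewrite EFinB.
  exact/esym/(nuE n.+1 (ltn0Sn n) y).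
under eq_cvg do rewrite /= r_estE.
apply: (cvg_mean_of_cdf (fun n => nu n.+1) KH cdf_cvg) => e e0.
by have [c hc] := ui e e0; exists c => n; exact: hc.
Qed.
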